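(* For every $\omega\in A_n$, $$F^d_\omega(\mathbf x,\mathbf y)=\sum_{T\in E(\omega)} R_{\mathrm{sh}(T)}(\mathbf x,\mathbf y),$$ where $E(\omega)$ is the set of Edelman–Greene tableaux for $\omega$ and $\mathrm{sh}(T)$ is the shape of $T$.
   Context: Let $W$ be the group generated by $s_{-n},\dots,s_{-1},s_0,s_1,\dots,s_n$ subject to $(s_as_b)^{m_{ab}}=1$, where $m_{ab}=1$ if $|a|=|b|$; $m_{ab}=3$ if $a,b\ne 0$ and $\bigl||a|-|b|\bigr|=1$; $m_{ab}=4$ if one of $a,b$ is $0$ and $\bigl||a|-|b|\bigr|=1$; $m_{ab}=2$ if $\bigl||a|-|b|\bigr|>1$. $A_n\subseteq W$ is the subgroup generated by $s_1,\dots,s_n$. A reduced word for $\omega$ is an expression in $s_{-n},\dots,s_n$ of minimal length. $RSIF_k(\omega)$ is the set of reduced words for $\omega$ together with a division into $k$ consecutive (possibly empty) blocks, each strictly increasing for $s_{-n}<\dots<s_0<\dots<s_n$; the double weight $(dw(v,1),dw(v,2))$ records in its $i$-th entries the number of generators with negative, resp. nonnegative, index in the $i$-th block. $F^d_\omega(x,y)=\sum_{v\in RSIF_k(\omega)}x^{dw(v,1)}y^{dw(v,2)}$ with $x=(x_1,\dots,x_k)$, $y=(y_1,\dots,y_k)$, and $F^d_\omega(\mathbf x,\mathbf y)$ is its limit as $k\to\infty$. An Edelman–Greene tableau for $\omega\in A_n$ is a filling of a Young diagram with $s_1,\dots,s_n$, strictly increasing along rows and columns, whose reading word (rows left to right,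 bottom row to top row) is a reduced word for $\omega$. A primed tableau of shape $\lambda/\mu$ over $\{1'<1<\dots<k'<k\}$ is a filling with rows and columns weakly increasing, at most one $i'$ per row and at most one $i$ per column for each $i$; its double weight $(X,Y)$ has $X(i)=\#\{i'\}$, $Y(i)=\#\{i\}$. $R_{\lambda/\mu}(x,y)=\sum_{T}x^{X}y^{Y}$ summed over all primed tableaux of shape $\lambda/\mu$ over this alphabet, and $R_{\lambda/\mu}(\mathbf x,\mathbf y)$ is the limit $k\to\infty$. *)

(* Defs.v *)
From HB Require Import structures.
From mathcomp Require Import all_boot all_order all_algebra.
From Stdlib Require Import ClassicalEpsilon.
Set Implicit Arguments. Unset Strict Implicit. Unset Printing Implicit Defensive.
Import GRing.Theory.

Definition Pb (P : Prop) : bool :=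
  if excluded_middle_informative P then true else false.

(* Generators s_{-n},...,s_n are encoded by i : 'I_(2n+1), with        *)
(* s_a <-> i = a + n.  The natural order on ordinals is thus           *)
(* s_{-n} < ... < s_0 < ... < s_n.                                    *)
Definition Letter (n : nat) := 'I_(n.*2.+1).

Definition absn (n : nat) (i : Letter n) : nat :=
  if (i < n)%N then (n - i)%N else (i - n)%N.

Definition mexp (n : nat) (i j : Letter n) : nat :=
  let d := ((absn i - absn j) + (absn j - absn i))%N in
  if d == 0%N then 1%N
  else if d == 1%N then (if (absn i == 0%N) || (absn j == 0%N) then 4%N else 3%N)
  else 2%N.

Definition relator (n : nat) (i j : Letter n) : seq (Letter n) :=
  flatten (nseq (mexp i j) [:: i; j]).

(* Two words represent the same element of W: the congruence on the free
   monoid generated by relator = empty word.  Since every s_a^2 = 1 is a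
   relator (m_{aa} = 1), the quotient monoid is the group W. *)
Inductive weq (n : nat) : seq (Letter n) -> seq (Letter n) -> Prop :=
| weq_refl w : weq w w
| weq_sym u v : weq u v -> weq v u
| weq_trans u v w : weq u v -> weq v w -> weq u w
| weq_rel (u v : seq (Letter n)) (i j : Letter n) :
    weq (u ++ relator i j ++ v) (u ++ v).

Definition reduced_word (n : nat) (v w : seq (Letter n)) : Prop :=
  weq v w /\ forall u, weq u w -> (size v <= size u)%N.

(* A reduced word together with a division into k consecutive blocks, *)
(* each strictly increasing, is the same as the k-tuple of its blocks; *)
(* a strictly increasing block is the increasing enumeration of a set  *)
(* of letters.  So we encode an element by B : 'I_k -> {set Letter n}, *)
(* the word being the concatenation of the increasing enumerations.    *)
Definition block_word (n k : nat) (B : {ffun 'I_k -> {set Letter n}})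
  : seq (Letter n) := flatten [seq enum (B i) | i <- enum 'I_k].

Definition dw1 (n k : nat) (B : {ffun 'I_k -> {set Letter n}}) (i : 'I_k) : nat :=
  #|[set j in B i | (j < n)%N]|.
Definition dw2 (n k : nat) (B : {ffun 'I_k -> {set Letter n}}) (i : 'I_k) : nat :=
  #|[set j in B i | (n <= j)%N]|.

Definition Fd (n : nat) (w : seq (Letter n)) (k : nat) (R : comNzRingType)
    (x y : 'I_k -> R) : R :=
  \sum_(B : {ffun 'I_k -> {set Letter n}} | Pb (reduced_word (block_word B) w))
     \prod_(i < k) (x i ^+ dw1 B i * y i ^+ dw2 B i).

(* Rows indexed from 0 (top), English convention.  Alphabet            *)
(* {1' < 1 < ... < k' < k} encoded by v : 'I_(2k): v = 2(i-1) is i',  *)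
(* v = 2(i-1)+1 is i.  A filling is a function on the bounding box     *)
(* with value None exactly outside the skew shape.                     *)
Definition ncols (lam : seq nat) : nat := \max_(r <- lam) r.

Definition in_skew (lam mu : seq nat) (r c : nat) : bool :=
  (r < size lam)%N && (nth 0 mu r <= c)%N && (c < nth 0 lam r)%N.

Definition filling (k : nat) (lam : seq nat) :=
  {ffun 'I_(size lam) * 'I_(ncols lam) -> option 'I_(k.*2)}.

Definition primed_tableau (k : nat) (lam mu : seq nat) (T : filling k lam) : Prop :=
  (forall p, (T p == None) = ~~ in_skew lam mu p.1 p.2) /\
  (forall (r : 'I_(size lam)) (c c' : 'I_(ncols lam)) (v v' : 'I_(k.*2)), (c < c')%N -> T (r, c) = Some v -> T (r, c') = Some v' ->
      (v <= v')%N) /\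
  (forall (r r' : 'I_(size lam)) (c : 'I_(ncols lam)) (v v' : 'I_(k.*2)), (r < r')%N -> T (r, c) = Some v -> T (r', c) = Some v' ->
      (v <= v')%N) /\
  (forall (r : 'I_(size lam)) (c c' : 'I_(ncols lam)) (v : 'I_(k.*2)), c != c' -> T (r, c) = Some v -> T (r, c') = Some v -> odd v) /\
  (forall (r r' : 'I_(size lam)) (c : 'I_(ncols lam)) (v : 'I_(k.*2)), r != r' -> T (r, c) = Some v -> T (r', c) = Some v -> ~~ odd v).

(* X(i) = number of entries i', Y(i) = number of entries i (i : 'I_k is i+1) *)
Definition wX (k : nat) (lam : seq nat) (T : filling k lam) (i : 'I_k) : nat :=
  #|[set p | if T p is Some v then (v == i.*2 :> nat) else false]|.
Definition wY (k : nat) (lam : seq nat) (T : filling k lam) (i : 'I_k) : nat :=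
  #|[set p | if T p is Some v then (v == i.*2.+1 :> nat) else false]|.

Definition Rskew (k : nat) (lam mu : seq nat) (R : comNzRingType) (x y : 'I_k -> R) : R :=
  \sum_(T : filling k lam | Pb (primed_tableau mu T))
     \prod_(i < k) (x i ^+ wX T i * y i ^+ wY T i).

(* Edelman-Greene tableaux.  A tableau is its list of rows (top row    *)
(* first); entry a in 1..n stands for s_a.                             *)
Definition tab_entry (n : nat) (a : nat) : Letter n := inord (n + a).

Definition sh (t : seq (seq nat)) : seq nat := map size t.

Definition reading_word (n : nat) (t : seq (seq nat)) : seq (Letter n) :=
  map (@tab_entry n) (flatten (rev t)).

Definition EG_tableau (n : nat) (w : seq (Letter n)) (t : seq (seq nat)) : Prop :=
  all (fun row => size row != 0%N) t /\ sorted geq (sh t) /\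
  all (fun row => all (fun a => (1 <= a <= n)%N) row) t /\
  all (sorted ltn) t /\
  (forall r r' c, (r < r')%N -> (c < size (nth [::] t r'))%N ->
     (nth 0 (nth [::] t r) c < nth 0 (nth [::] t r') c)%N) /\
  reduced_word (reading_word n t) w.

(* Main.v *)
(* Since s_{-a} = s_a, a division of a reduced word into increasing blocks over
   s_{-n}, ..., s_n is a reduced word over s_1, ..., s_n cut into blocks that
   alternately decrease (the negative letters) and increase.  Edelman-Greene
   insertion sends a reduced word a to a pair (P, j), where P is an
   Edelman-Greene tableau for the same permutation and j_i is the row of the box
   created at step i; it is a bijection onto the pairs in which every prefix of j
   has partition content, with j containing as many r's as row r of P has boxes.
   By the row bumping lemma a_i < a_{i+1} iff j_{i+1} <= j_i.  Hence a
   decreasing block adds a vertical strip of boxes and an increasing block a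
   horizontal strip, and recording in each new box the block it comes from gives
   exactly the primed tableaux of the shape of P, with the same weight. *)
Require Import Defs.
From HB Require Import structures.
From mathcomp Require Import all_boot all_order all_algebra.
From mathcomp Require Import zify.
From Stdlib Require Import ClassicalEpsilon.
Set Implicit Arguments. Unset Strict Implicit. Unset Printing Implicit Defensive.

(** * Reduced words *)

(** The group is handled through its presentation: an element is a class of [weq], and reducedness
    means that no equivalent word is shorter. An insertion step rewrites the word by commutations
    and braid relations, keeping class and length; the one configuration that [Bump] leaves out
    would expose a cancelling pair of equal letters. Words over all the generators might contain
    [s_0]; deleting it respects the relations and fixes words in positive letters, so minimal words
    of elements of [A_n] avoid it. Blocks and entries share one numbering from 0: block [i] gives
    the value [2i] to its negative letters and [2i+1] to the others, just as the alphabet codes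
    primed and unprimed entries. A division is then a list of pairs of a value and a letter,
    strictly sorted for an order whose direction within a value depends on parity; empty blocks
    leave no trace. The bumping lemma allows rows to replace letters in these pairs. Sortedness then
    yields the row conditions of the filling, and together with the prefix condition also the column
    conditions. *)

Lemma PbP (P : Prop) : reflect P (Pb P).
Proof. by rewrite /Pb; case: excluded_middle_informative => h; constructor. Qed.

Section Coxeter.
Variable n : nat.
Implicit Types (u v w : seq (Letter n)) (s t l m : seq nat).

Lemma weq_ctx (p q : seq (Letter n)) u v : weq u v -> weq (p ++ u ++ q) (p ++ v ++ q).
Proof.
elim=> [w|u1 v1 _|u1 v1 w1 _ h1 _|u1 v1 i j].
- exact: weq_refl.
- exact: weq_sym.
- exact: weq_trans h1.
- by rewrite -!catA !(catA p); apply: weq_rel.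
Qed.

Lemma weq_relator (i j : Letter n) : weq (relator i j) [::].
Proof. by have := @weq_rel n [::] [::] i j; rewrite cats0. Qed.

Lemma weq_abs (i j : Letter n) : absn i = absn j -> weq [:: i; j] [::].
Proof.
move=> e; have := weq_relator i j.
by rewrite /relator /mexp e subnn.
Qed.

Lemma weq_cat u u' v v' : weq u u' -> weq v v' -> weq (u ++ v) (u' ++ v').
Proof.
move=> h1 h2; apply: (@weq_trans _ _ (u' ++ v)).
  by have := weq_ctx [::] v h1.
by have := weq_ctx u' [::] h2; rewrite !cats0.
Qed.

Lemma weq_flip (i j : Letter n) : absn i = absn j -> weq [:: i] [:: j].
Proof.
move=> e; apply: (@weq_trans _ _ [:: i; i; j]).
  by apply: weq_sym; apply: (@weq_ctx [:: i] [::] [:: i; j] [::]); apply: weq_abs.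
by apply: (@weq_ctx [::] [:: j] [:: i; i] [::]); apply: weq_abs.
Qed.

Definition gens s : seq (Letter n) := map (@tab_entry n) s.

Definition inrange s := all (fun a => 1 <= a <= n) s.

Lemma gens_cat s t : gens (s ++ t) = gens s ++ gens t.
Proof. exact: map_cat. Qed.

Lemma val_tab_entry a : a <= n -> tab_entry n a = n + a :> nat.
Proof. by move=> h; rewrite /tab_entry inordK //; lia. Qed.

Lemma absn_tab_entry a : a <= n -> absn (tab_entry n a) = a.
Proof. move=> h; rewrite /absn val_tab_entry //; case: ifP; lia. Qed.

(** * Commutation and braid relations among the positive generators *)

Definition eqv s t := weq (gens s) (gens t).

Lemma eqv_refl s : eqv s s. Proof. exact: weq_refl. Qed.
Lemma eqv_sym s t : eqv s t -> eqv t s. Proof. exact: weq_sym. Qed.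
Lemma eqv_trans t s r : eqv s t -> eqv t r -> eqv s r.
Proof. exact: weq_trans. Qed.

Lemma eqv_cat s s' t t' : eqv s s' -> eqv t t' -> eqv (s ++ t) (s' ++ t').
Proof. by rewrite /eqv !gens_cat; apply: weq_cat. Qed.

Lemma eqv_ctx p q s t : eqv s t -> eqv (p ++ s ++ q) (p ++ t ++ q).
Proof. by move=> h; do 2?apply: eqv_cat => //; apply: eqv_refl. Qed.

Lemma eqv_square a : eqv [:: a; a] [::].
Proof. exact: weq_abs. Qed.

Lemma eqv_commute a b : a <= n -> b <= n -> a.+1 < b -> eqv [:: a; b] [:: b; a].
Proof.
move=> ha hb hab.
have hr : weq (relator (tab_entry n a) (tab_entry n b)) [::] by apply: weq_relator.
have e : relator (tab_entry n a) (tab_entry n b) = gens [:: a; b; a; b].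
  rewrite /relator /mexp !absn_tab_entry //.
  by rewrite !(@gtn_eqF _ (a - b + (b - a))) //; lia.
rewrite e in hr.
(* Inserting squares turns [ab] into [(abab)(ba)], and the relator [abab] is dropped; the braid
   relation arises likewise from [(ab)^3]. *)
apply: (@eqv_trans ([:: a; b] ++ [:: a; a] ++ [::])).
  by apply: eqv_sym; apply: (@eqv_ctx [:: a; b] [::] _ [::]); apply: eqv_square.
apply: (@eqv_trans ([:: a; b; a] ++ [:: b; b] ++ [:: a])).
  apply: eqv_sym; apply: (@eqv_ctx [:: a; b; a] [:: a] _ [::]).
  exact: eqv_square.
exact: (@eqv_ctx [::] [:: b; a] [:: a; b; a; b] [::]).
Qed.

Lemma eqv_braid a : 0 < a -> a < n -> eqv [:: a; a.+1; a] [:: a.+1; a; a.+1].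
Proof.
move=> h0 ha; set b := a.+1.
have hr : weq (relator (tab_entry n a) (tab_entry n b)) [::] by apply: weq_relator.
have e : relator (tab_entry n a) (tab_entry n b) = gens [:: a; b; a; b; a; b].
  rewrite /relator /mexp !absn_tab_entry //; last exact: ltnW.
  rewrite (_ : a - b + (b - a) = 1) /=; last by rewrite /b; lia.
  by rewrite (gtn_eqF h0).
rewrite e in hr.
apply: (@eqv_trans ([:: a; b; a] ++ [:: b; b] ++ [::])).
  by apply: eqv_sym; apply: (@eqv_ctx _ [::] _ [::]); apply: eqv_square.
apply: (@eqv_trans ([:: a; b; a; b] ++ [:: a; a] ++ [:: b])).
  by apply: eqv_sym; apply: (@eqv_ctx _ [:: b] _ [::]); apply: eqv_square.
apply: (@eqv_trans ([:: a; b; a; b; a] ++ [:: b; b] ++ [:: a; b])).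
  by apply: eqv_sym; apply: (@eqv_ctx [:: a; b; a; b; a] [:: a; b] _ [::]);
     apply: eqv_square.
exact: (@eqv_ctx [::] [:: b; a; b] [:: a; b; a; b; a; b] [::]).
Qed.

Lemma eqv_commute_seq x m : inrange (x :: m) ->
  all (fun a => (x.+1 < a) || (a.+1 < x)) m -> eqv (rcons m x) (x :: m).
Proof.
rewrite /inrange; elim: m => [|a m IH] /=; first by move=> *; apply: eqv_refl.
case/and3P=> hx ha hm /andP[hax hmx].
apply: (@eqv_trans ([:: a] ++ (x :: m))).
  by apply: (@eqv_cat [:: a] _ (rcons m x)); [apply: eqv_refl|apply: IH;
    rewrite //= hx].
apply: (@eqv_ctx [::] m [:: a; x] [:: x; a]).
case/orP: hax => h; last by apply: eqv_commute; lia.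
by apply: eqv_sym; apply: eqv_commute; lia.
Qed.

(** Minimality is tested against words in all generators, as in [reduced_word], but no fixed [w] is
    involved, so the property passes to factors. *)
Definition reduced s := inrange s /\ forall u, weq u (gens s) -> size s <= size u.

Lemma reduced_eqv s t : inrange t -> eqv s t -> size t = size s -> reduced s ->
  reduced t.
Proof.
move=> ht hst e [hs h]; split=> // u hu; rewrite e; apply: h.
by apply: weq_trans hu _; apply: eqv_sym.
Qed.

Lemma reduced_infix p q s : reduced (p ++ s ++ q) -> reduced s.
Proof.
rewrite /reduced /inrange !all_cat => -[/and3P[_ hs _] h]; split=> // u hu.
have := h (gens p ++ u ++ gens q); rewrite !gens_cat !size_cat !size_map.
move=> /(_ (weq_ctx _ _ hu)); lia.
Qed.

Lemma reduced_catl s q : reduced (s ++ q) -> reduced s.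
Proof. exact: (@reduced_infix [::]). Qed.

Lemma reduced_catr p s : reduced (p ++ s) -> reduced s.
Proof. by move=> h; apply: (@reduced_infix p [::]); rewrite cats0. Qed.

Lemma reduced_short s t : reduced s -> eqv t s -> size s <= size t.
Proof. by case=> _ h /h; rewrite size_map. Qed.

(** The last [a] commutes past [m] and cancels against the first, leaving the shorter word [m]. *)
Lemma not_reduced_commute a m : all (fun b => (a.+1 < b) || (b.+1 < a)) m ->
  ~ reduced (a :: rcons m a).
Proof.
move=> hm h.
have hr : inrange (a :: m).
  by case: h; rewrite /inrange -rcons_cons all_rcons => /andP[].
have e1 := eqv_commute_seq hr hm.
have : eqv m (a :: rcons m a).
  apply: eqv_sym; apply: (@eqv_trans ([::] ++ [:: a; a] ++ m)).
    by apply: (@eqv_cat [:: a] [:: a] (rcons m a) (a :: m)) => //; apply: eqv_refl.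
  exact: (@eqv_ctx [::] m [:: a; a] [::] (eqv_square a)).
by move/(reduced_short h); rewrite /= size_rcons; lia.
Qed.

Lemma reduced_neq x y : reduced [:: x; y] -> x != y.
Proof. by move=> h; apply/eqP=> e; apply: (@not_reduced_commute x [::]);
  rewrite // {2}e. Qed.

(* Deleting every s_0 respects the relators, so a reduced word of an
   element of A_n contains no s_0. *)
Definition drop0 u := [seq i : Letter n <- u | i != n :> nat].

Lemma absn0 (i : Letter n) : (absn i == 0) = (i == n :> nat).
Proof. by rewrite /absn; case: ifP; lia. Qed.

Lemma weq_power2 (i : Letter n) : weq [:: i; i] [::].
Proof. exact: weq_abs. Qed.

(** A relator pairing [s_0] with another generator has exponent 2 or 4, so deleting [s_0] leaves an
    even power of an involution. *)
Lemma drop0_relator (i j : Letter n) : weq (drop0 (relator i j)) [::].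
Proof.
have h4 (a : Letter n) : @weq n [:: a; a; a; a] [::].
  apply: weq_trans (weq_power2 a).
  exact: (@weq_ctx [:: a; a] [::] [:: a; a] [::] (weq_power2 a)).
have [/eqP hi|/eqP hi] := boolP (absn i == 0);
have [/eqP hj|/eqP hj] := boolP (absn j == 0).
- by rewrite /relator /mexp hi hj /= -!absn0 hi hj; apply: weq_refl.
- rewrite /relator /mexp hi /= !sub0n !subn0 add0n (introF eqP hj).
  case: ifP => _ /=; rewrite -!absn0 hi (introF eqP hj) /=; first exact: h4.
  exact: weq_power2.
- rewrite /relator /mexp hj /= !sub0n !subn0 addn0 (introF eqP hi).
  rewrite orbT; case: ifP => _ /=; rewrite -!absn0 hj (introF eqP hi) /=.
    exact: h4.
  exact: weq_power2.
- have h : all (fun c : Letter n => c != n :> nat) (relator i j).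
    apply/allP => c /flattenP[s]; rewrite mem_nseq => /andP[_ /eqP->].
    by rewrite !inE => /orP[]/eqP->; rewrite -absn0; apply/eqP.
  rewrite /drop0 (elimT all_filterP h); exact: weq_relator.
Qed.

Lemma weq_drop0 u v : weq u v -> weq (drop0 u) (drop0 v).
Proof.
elim=> [w|u1 v1 _|u1 v1 w1 _ h1 _|u1 v1 i j].
- exact: weq_refl.
- exact: weq_sym.
- exact: weq_trans h1.
- rewrite /drop0 !filter_cat; apply: (@weq_ctx _ _ _ [::]); exact: drop0_relator.
Qed.

Lemma weq_gens_absn u : weq u (gens (map (@absn n) u)).
Proof.
elim: u => [|i u IH]; first exact: weq_refl.
apply: (@weq_cat [:: i] [:: tab_entry n (absn i)] u) => //.
apply: weq_flip; rewrite absn_tab_entry // /absn.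
by case: ifP; have := ltn_ord i; lia.
Qed.

Definition reduced_for w s := inrange s /\ reduced_word (gens s) w.

(** If [u] is minimal for [w], deleting [s_0] from it gives again a word for [w], so nothing was
    deleted; absolute values then change neither class nor length. *)
Lemma reduced_for_absn w u : all (fun i : Letter n => n < i) w ->
  reduced_word u w <-> reduced_for w (map (@absn n) u).
Proof.
move=> hw; split=> -[h1 h2]; last first.
  case: h2 => h2 h3; split; last by move=> v /h3; rewrite !size_map.
  exact: weq_trans (weq_gens_absn u) h2.
split; last first.
  split; first by apply: weq_trans h1; apply: weq_sym; apply: weq_gens_absn.
  by move=> v /h2; rewrite !size_map.
have h3 : weq (drop0 u) w.
  have := weq_drop0 h1; rewrite [drop0 w](_ : _ = w) //.
  by apply/all_filterP; apply: sub_all hw => i; lia.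
have {h2}h3 := h2 _ h3.
have : all (fun i : Letter n => i != n :> nat) u.
  by rewrite all_count eqn_leq count_size -size_filter.
rewrite /inrange all_map; apply: sub_all => i /= hi.
rewrite lt0n absn0 hi /= /absn; case: ifP => _; have := ltn_ord i; lia.
Qed.

Lemma reduced_for_reduced w s : reduced_for w s -> reduced s.
Proof.
case=> h [h1 h2]; split=> // u hu; rewrite -(size_map (@tab_entry n)).
by apply: h2; apply: weq_trans hu h1.
Qed.

Lemma reduced_for_eqv w s t : inrange t -> eqv s t -> size t = size s ->
  reduced_for w s -> reduced_for w t.
Proof.
move=> ht hst e [hs [h1 h2]]; split=> //; split; last by move=> u /h2;
  rewrite !size_map e.
by apply: weq_trans h1; apply: weq_sym.
Qed.

End Coxeter.

(** * Edelman-Greene insertion *)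

Section Insertion.
Implicit Types (r l m : seq nat) (T : seq (seq nat)).

Lemma sorted_ltn_cat l x m : sorted ltn (l ++ x :: m) =
  [&& all (fun a => a < x) l, all (fun a => x < a) m, sorted ltn l & sorted ltn m].
Proof.
rewrite !(sorted_pairwise ltn_trans) pairwise_cat pairwise_cons /allrel.
rewrite (eq_all (a1 := fun y => all (ltn y) (x :: m)) 
                (a2 := fun y => (y < x) && all (ltn y) m)) //.
apply/idP/idP.
  by case/and4P=> h1 -> -> ->; rewrite !andbT; apply: sub_all h1 => a /andP[].
case/and4P=> h1 h2 -> ->; rewrite h2 !andbT; apply: sub_all h1 => a hax.
by rewrite hax; apply: sub_all h2 => b; apply: ltn_trans.
Qed.

(* Bump r x y r': inserting x in r bumps y and leaves r'.  The Edelman-Greene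
   rule differs from row insertion when x and x+1 both occur in r: the row is
   then kept and x+1 is bumped. *)
Inductive Bump : seq nat -> nat -> nat -> seq nat -> Prop :=
| Bump_swap l m x y : all (fun a => a < x) l -> x < y -> all (fun a => y < a) m ->
    Bump (l ++ y :: m) x y (l ++ x :: m)
| Bump_keep l m x : all (fun a => a < x) l -> all (fun a => x.+1 < a) m ->
    Bump (l ++ x :: x.+1 :: m) x x.+1 (l ++ x :: x.+1 :: m).

(** Functional form of [Bump], used to compute insertion; where [Bump] does not apply the values are
    meaningless. *)
Definition bump_letter r x := head 0 [seq a <- r | x < a].
Definition bump_row r x :=
  if x \in r then r else [seq a <- r | a < x] ++ x :: behead [seq a <- r | x < a].

Lemma all_lt_filter l (p : pred nat) : all p l -> [seq a <- l | p a] = l.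
Proof. by move=> h; apply/all_filterP. Qed.

Lemma all_lt_filter0 l (p q : pred nat) : all q l -> (forall a, q a -> ~~ p a) ->
  [seq a <- l | p a] = [::].
Proof.
move=> h hpq; apply/eqP; rewrite -(negbK (_ == _)) -has_filter -all_predC.
exact: sub_all h.
Qed.

Lemma Bump_compute r x y r' : Bump r x y r' ->
  [/\ ~~ all (fun a => a < x) r, bump_letter r x = y & bump_row r x = r'].
Proof.
case=> {r x y r'} [l m x y hl hxy hm|l m x hl hm].
  have hm' : all (fun a => x < a) m.
    by apply: sub_all hm => a; apply: ltn_trans.
  have e : [seq a <- l ++ y :: m | x < a] = y :: m.
    rewrite filter_cat /= hxy (all_lt_filter hm') (all_lt_filter0 hl) // => a; lia.
  split.
  - by rewrite all_cat /= ltnNge (ltnW hxy) andbF.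
  - by rewrite /bump_letter e.
  - rewrite /bump_row e mem_cat inE (ltn_eqF hxy).
    rewrite [x \in l](negbTE (_ : _)); last first.
      by apply/negP => /(allP hl); rewrite ltnn.
    rewrite [x \in m](negbTE (_ : _)); last first.
      by apply/negP => /(allP hm'); rewrite ltnn.
    rewrite filter_cat /= ltnNge (ltnW hxy) (all_lt_filter hl).
    by rewrite (all_lt_filter0 hm') ?cats0 // => a; lia.
split.
- by rewrite all_cat /= ltnn andbF.
- rewrite /bump_letter filter_cat /= ltnn ltnSn (all_lt_filter0 hl) //= => a; lia.
- by rewrite /bump_row mem_cat inE eqxx orbT.
Qed.

(** Reverse bumping: the letter that bumped [y] is the largest entry below [y], and a row still
    containing [y] was kept. *)
Definition unbump_letter r y := last 0 [seq a <- r | a < y].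
Definition unbump_row r y :=
  if y \in r then r
  else [seq a <- r | a < unbump_letter r y] ++ y :: [seq a <- r | y < a].

Lemma Bump_uncompute r x y r' : Bump r x y r' ->
  [/\ ~~ all (fun a => y < a) r', unbump_letter r' y = x & unbump_row r' y = r].
Proof.
case=> {r x y r'} [l m x y hl hxy hm|l m x hl hm].
  have hl' : all (fun a => a < y) l.
    by apply: sub_all hl => a h; apply: ltn_trans h hxy.
  have e : unbump_letter (l ++ x :: m) y = x.
    rewrite /unbump_letter filter_cat /= hxy (all_lt_filter hl').
    by rewrite (all_lt_filter0 hm) ?last_cat // => a; lia.
  have hm' : all (fun a => x < a) m.
    by apply: sub_all hm => a; apply: ltn_trans.
  split=> //.
  - by rewrite all_cat /= ltnNge (ltnW hxy) andbF.
  - rewrite /unbump_row e mem_cat inE (gtn_eqF hxy).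
    rewrite [y \in l](negbTE (_ : _)); last first.
      by apply/negP => /(allP hl'); rewrite ltnn.
    rewrite [y \in m](negbTE (_ : _)); last first.
      by apply/negP => /(allP hm); rewrite ltnn.
    rewrite !filter_cat /= ltnn (all_lt_filter hl) (all_lt_filter hm).
    rewrite [y < x]ltnNge (ltnW hxy) /=.
    rewrite (all_lt_filter0 hm') ?cats0; last by move=> a; lia.
    by rewrite (all_lt_filter0 hl') // => a; lia.
split.
- by rewrite all_cat /= ltnNge leqnSn andbF.
- rewrite /unbump_letter filter_cat /= ltnSn ltnn (all_lt_filter0 hm);
  last by move=> a; lia.
  by rewrite last_cat.
- by rewrite /unbump_row mem_cat !inE eqxx !orbT.
Qed.

Lemma Bump_inj r1 x1 r2 x2 y r' :
  Bump r1 x1 y r' -> Bump r2 x2 y r' -> r1 = r2 /\ x1 = x2.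
Proof. by move=> /Bump_uncompute[_ <- <-] /Bump_uncompute[_ <- <-]. Qed.

Lemma Bump_size r x y r' : Bump r x y r' -> size r' = size r.
Proof. by case=> *; rewrite !size_cat. Qed.

Lemma Bump_lt r x y r' : Bump r x y r' -> x < y.
Proof. by case. Qed.

Lemma Bump_mem r x y r' : Bump r x y r' -> x \in r'.
Proof. by case=> *; rewrite mem_cat inE eqxx orbT. Qed.

Lemma Bump_sorted r x y r' : Bump r x y r' -> sorted ltn r -> sorted ltn r'.
Proof.
case=> {r x y r'} // l m x y hl hxy hm.
rewrite !sorted_ltn_cat => /and4P[_ _ -> ->]; rewrite hl !andbT.
by apply: sub_all hm => a; apply: ltn_trans.
Qed.

Lemma Bump_sorted_inv r x y r' : Bump r x y r' -> sorted ltn r' -> sorted ltn r.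
Proof.
case=> {r x y r'} // l m x y hl hxy hm.
rewrite !sorted_ltn_cat => /and4P[_ _ -> ->]; rewrite hm !andbT.
by apply: sub_all hl => a h; apply: ltn_trans h hxy.
Qed.

(** Entries of [r'] above [x] are at least [y], and [y] itself survives only in a kept row, where
    [y = x+1 <= x'] and [x' < y']. *)
Lemma Bump_incr r x y r' x' y' r'' : Bump r x y r' -> Bump r' x' y' r'' ->
  x < x' -> y < y'.
Proof.
move=> h1 h2 hx; have := Bump_lt h2; have : y' \in r' /\ True.
  split=> //; case: h2 => *; rewrite mem_cat !inE eqxx ?orbT //.
case: h1 => {r x y r' h2} [l m x y hl hxy hm|l m x hl hm] in hx * => -[+ _]; last lia.
rewrite mem_cat inE => /or3P[/(allP hl)|/eqP->|/(allP hm)]; lia.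
Qed.

(** [x] now sits in [r'] and exceeds [x'], so the second bump ejects at most [x], which is below
    [y]. *)
Lemma Bump_decr r x y r' x' y' r'' : Bump r x y r' -> Bump r' x' y' r'' ->
  x' < x -> y' < y.
Proof.
move=> h1 h2 hx; have hm := Bump_mem h1; have := Bump_lt h1.
suff : y' <= x by lia.
case: h2 hm hx => {r x' y' r' r'' h1} [l m x' y' hl hxy hm|l m x' hl hm].
  rewrite mem_cat inE => /or3P[/(allP hl)|/eqP->|/(allP hm)]; lia.
by rewrite mem_cat !inE => /or4P[/(allP hl)|/eqP->|/eqP->|/(allP hm)]; lia.
Qed.

(** * The column condition between consecutive rows *)

Inductive RowIns : seq nat -> nat -> seq nat -> Prop :=
| RowIns_app r x : all (fun a => a < x) r -> RowIns r x (rcons r x)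
| RowIns_bump r x y r' : Bump r x y r' -> RowIns r x r'.

Definition compat r0 r1 :=
  (size r1 <= size r0) && all (fun c => nth 0 r0 c < nth 0 r1 c) (iota 0 (size r1)).

Lemma compatP r0 r1 : reflect
  (size r1 <= size r0 /\ forall c, c < size r1 -> nth 0 r0 c < nth 0 r1 c)
  (compat r0 r1).
Proof.
apply: (iffP andP) => -[h1 h2]; split=> //.
  by move=> c hc; apply: (allP h2); rewrite mem_iota.
by apply/allP => c; rewrite mem_iota => /h2.
Qed.

Lemma nth_all (p : pred nat) l c : all p l -> c < size l -> p (nth 0 l c).
Proof. by move=> h hc; apply: (allP h); apply: mem_nth. Qed.

(** One form for every way in which [y] enters the lower row: [y :: behead m1] appends if [m1] is
    empty and otherwise replaces its head; a kept row replaces [y] by itself. *)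
Lemma compat_set r0 r0' l1 m1 y :
  compat r0 (l1 ++ m1) -> size r0' = size r0 -> size l1 < size r0 ->
  (forall c, nth 0 r0' c <= nth 0 r0 c) -> nth 0 r0' (size l1) < y ->
  compat r0' (l1 ++ y :: behead m1).
Proof.
move=> /compatP[h1 h2] hs hl hle hy; apply/compatP; split.
  by move: h1; rewrite !size_cat /= size_behead; lia.
move=> c hc; rewrite nth_cat; case: (ltngtP c (size l1)) => hcl.
- apply: leq_ltn_trans (hle c) _; have := h2 c; rewrite nth_cat hcl.
  by apply; rewrite size_cat; lia.
- have e : c - size l1 = (c - size l1).-1.+1 by lia.
  rewrite e /= nth_behead -e; apply: leq_ltn_trans (hle c) _.
  have := h2 c; rewrite nth_cat (ltnNge c (size l1)) (ltnW hcl) /=; apply.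
  by move: hc; rewrite !size_cat /= size_behead; lia.
- by rewrite hcl subnn.
Qed.

(** A bumped letter moves weakly left: in column [size l] the lower row has no entry below [y],
    being larger than the upper one there, hence [size l1 <= size l]. *)
Lemma compat_forward r0 x y r0' r1 r1' : sorted ltn r0 ->
  Bump r0 x y r0' -> RowIns r1 y r1' -> compat r0 r1 -> compat r0' r1'.
Proof.
move=> hsort hb hr hc.
have main l1 m1 : all (fun a => a < y) l1 -> compat r0 (l1 ++ m1) ->
    compat r0' (l1 ++ y :: behead m1).
  move=> hl1 hcm.
  have hlt c : c < size l1 -> nth 0 r0 c < nth 0 l1 c /\ nth 0 l1 c < y.
    move=> hcl; split; last exact: nth_all hl1 hcl.
    have /compatP[_ /(_ c)] := hcm; rewrite nth_cat hcl; apply.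
    by rewrite size_cat; lia.
  case: hb (hb) hsort hcm hlt {hc hr hl1}
      => {r0 x y r0'} [l m x y hl hxy hm|l m x hl hm] hb hsort hcm hlt.
    have hsz : size l1 <= size l.
      rewrite leqNgt; apply/negP => /hlt; rewrite nth_cat ltnn subnn /=; lia.
    apply: compat_set hcm _ _ _ _; rewrite ?size_cat //=; first by lia.
      by move=> c; rewrite !nth_cat; case: (ltnP c (size l)) => // _;
        case: (_ - _) => //=; lia.
    rewrite nth_cat; case: (ltnP (size l1) (size l)) => h;
      first by have := nth_all hl h; lia.
    by rewrite (_ : _ - _ = 0) //; lia.
  have hsz : size l1 <= size l.
    rewrite leqNgt; apply/negP => /hlt; rewrite nth_cat ltnn subnn /=; lia.
  apply: compat_set hcm _ _ _ _; rewrite ?size_cat //=; first by lia.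
  rewrite nth_cat; case: (ltnP (size l1) (size l)) => h;
    first by have := nth_all hl h; lia.
  by rewrite (_ : _ - _ = 0) //; lia.
case: hr main hc {hb} => {r1 y r1'} [r y hr|r y z r' hb] main hc.
  by have := main r [::] hr; rewrite cats0 -cats1; apply.
case: hb main hc => {r y z r'} [l m y z hl hyz hm|l m y hl hm] main hc.
  exact: (main l (z :: m)).
exact: (main l (y :: y.+1 :: m)).
Qed.

(** In a swap only column [size l] changes back, from [x] to [y]. Further right [r0'] exceeds [y],
    so [y] entered the lower row weakly left of that column, where [r1] therefore exceeds [y]. *)
Lemma compat_backward r0 x y r0' r1 r1' :
  Bump r0 x y r0' -> RowIns r1 y r1' -> compat r0' r1' -> compat r0 r1.
Proof.
move=> hb hr /compatP[hs hc].
have hr1 : size r1 <= size r1'.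
  by case: hr => [r a _|r a b r' /Bump_size->] //; rewrite size_rcons.
have hle c : c < size r1 -> nth 0 r1' c <= nth 0 r1 c.
  case: hr {hs hc hr1 hb} => {r1 y r1'} [r y hr|r y z r' hb] h.
    by rewrite nth_rcons h.
  case: hb h => {r y z r'} [l m y z hl hyz hm|l m y hl hm] h //.
  by rewrite !nth_cat; case: (ltnP c (size l)) => // _; case: (_ - _) => //=; lia.
apply/compatP; split; first by rewrite -(Bump_size hb); lia.
move: hr hs hc hr1 hle.
case: hb => {r0 x y r0'} [l m x y hl hxy hm|l m x hl hm] hr hs hc hr1 hle c hcs;
  last by apply: leq_trans (hc c _) (hle c hcs); lia.
have [ecl|ncl] := eqVneq c (size l); last first.
  apply: leq_trans (leq_trans (hc c _) (hle c hcs)); last lia.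
  rewrite !nth_cat; case: (ltnP c (size l)) => // hcl.
  by rewrite (_ : c - size l = (c - size l).-1.+1) //; move/eqP: ncl; lia.
rewrite nth_cat ecl ltnn subnn /= -ecl.
(* The bound [y.+1] serves the kept lower row: its entry [y.+1] then lies in a column at most
   [size l], so [y] is strictly to the left. *)
have hpos p : p < size r1' -> nth 0 r1' p <= y.+1 -> p <= size l.
  move=> hp; have := hc p hp; rewrite nth_cat; case: (ltnP p (size l)) => [|_];
    first by lia.
  case e : (p - size l) => [|q] /=; first by lia.
  have hq : q < size m by move: hs; rewrite size_cat /=; lia.
  have := nth_all hm hq; rewrite /=; lia.
case: hr hcs hpos {hs hc hle hr1 hxy hm} => {r1 y r1'} [r y hr|r y z r' hb] hcs hpos.
  have := hpos (size r); rewrite size_rcons ltnSn nth_rcons ltnn eqxx.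
  by move=> /(_ isT (leqnSn _)); lia.
case: hb hcs hpos => {r y z r'} [l1 m1 y z hl1 hyz hm1|l1 m1 y hl1 hm1] hcs hpos.
  have := hpos (size l1); rewrite size_cat /= nth_cat ltnn subnn /= leqnSn.
  move=> /(_ _ isT) hp; have {}hp : size l1 <= size l by apply: hp; lia.
  rewrite nth_cat ecl (ltnNge (size l)) hp /=; case e : (_ - _) => [|q] //=.
  have hq : q < size m1 by move: hcs; rewrite size_cat /=; lia.
  by have := nth_all hm1 hq; rewrite /=; lia.
have e1 : ((size l1).+1 < size l1) = false by lia.
have := hpos (size l1).+1; rewrite size_cat /= nth_cat e1 subSnn /= leqnn.
move=> /(_ _ isT) hp; have {}hp : size l1 < size l by apply: hp; lia.
rewrite nth_cat ecl (ltnNge (size l)) (ltnW hp) /=.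
case e : (_ - _) => [|[|q]] //=; first by lia.
have hq : q < size m1 by move: hcs; rewrite size_cat /=; lia.
by have := nth_all hm1 hq; rewrite /=; lia.
Qed.

Fixpoint tab T := if T is r :: rs then
  [&& r != [::], sorted ltn r, compat r (head [::] rs) & tab rs] else true.

Fixpoint ins T x {struct T} : seq (seq nat) * nat :=
  if T is r :: rs then
    if all (fun a => a < x) r then (rcons r x :: rs, 0)
    else let: (rs', j) := ins rs (bump_letter r x) in (bump_row r x :: rs', j.+1)
  else ([:: [:: x]], 0).

Definition row_word T := flatten (rev T).

Lemma row_word_cons r T : row_word (r :: T) = row_word T ++ r.
Proof. by rewrite /row_word rev_cons flatten_rcons. Qed.

End Insertion.

(** * Insertion of one letter into the tableau of a reduced word *)

Section Correspondence.
Variable n : nat.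
Implicit Types (r l m : seq nat) (T : seq (seq nat)).
Local Notation eqv := (eqv n).
Local Notation reduced := (reduced n).

Lemma inrange_cat l m : inrange n (l ++ m) = inrange n l && inrange n m.
Proof. exact: all_cat. Qed.

Lemma eqv_commute_all x m : inrange n (x :: m) ->
  all (fun a => (x.+1 < a) || (a.+1 < x)) m -> eqv (m ++ [:: x]) (x :: m).
Proof. by rewrite cats1; apply: eqv_commute_seq. Qed.

(** In a swap [x] commutes left past [m] and [y] left past [l]. In a kept row such moves surround
    the braid from [x (x+1) x] to [(x+1) x (x+1)], which explains both the kept row and the bumped
    [x+1]. *)
Lemma Bump_eqv r x y r' : Bump r x y r' -> inrange n (rcons r x) ->
  inrange n (y :: r') /\ eqv (rcons r x) (y :: r').
Proof.
rewrite -cats1.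
case=> {r x y r'} [l m x y hl hxy hm|l m x hl hm];
  rewrite -catA /= inrange_cat /= cats1 /inrange /= all_rcons -/(inrange n _).
  case/and4P=> hL hy hx hM; split.
    by rewrite /= hy all_cat /= hx; apply/andP.
  rewrite -cats1.
  apply: (@eqv_trans _ ((l ++ [:: y]) ++ x :: m)).
    rewrite -cat_rcons -cats1; apply: eqv_cat; first exact: eqv_refl.
    apply: eqv_commute_all; first by rewrite /inrange /= hx.
    by apply: sub_all hm => a; lia.
  rewrite -cat_cons; apply: eqv_cat; last exact: eqv_refl.
  apply: eqv_commute_all; first by rewrite /inrange /= hy.
  by apply: sub_all hl => a; lia.
case/and5P=> hL hx hx1 _ hM; split.
  by rewrite /= hx1 all_cat /= hx hx1; apply/andP.
rewrite -cats1.
apply: (@eqv_trans _ (l ++ ([:: x; x.+1; x] ++ m))).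
  apply: eqv_cat; first exact: eqv_refl.
  apply: (@eqv_cat _ [:: x; x.+1] [:: x; x.+1]); first exact: eqv_refl.
  apply: eqv_commute_all; first by rewrite /inrange /= hx.
  by apply: sub_all hm => a; lia.
apply: (@eqv_trans _ (l ++ ([:: x.+1; x; x.+1] ++ m))).
  by apply: eqv_ctx; apply: eqv_braid; lia.
rewrite -cat_cons (_ : l ++ _ = (l ++ [:: x.+1]) ++ [:: x, x.+1 & m]);
  last by rewrite -catA.
apply: (@eqv_cat _ _ (x.+1 :: l)); last exact: eqv_refl.
apply: eqv_commute_all; first by rewrite /inrange /= hx1.
by apply: sub_all hl => a; lia.
Qed.

(** Only an [x] in the row without [x+1] escapes both rules; the inserted [x] would then commute
    back to it and cancel. *)
Lemma Bump_exists r x : sorted ltn r -> reduced (rcons r x) ->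
  ~~ all (fun a => a < x) r -> exists y r', Bump r x y r'.
Proof.
move=> hs hr; rewrite -has_predC => hh.
case/split_find: hh hs hr => y l m /= hy; rewrite -all_predC => hl.
have {}hl : all (fun a => a < x) l by apply: sub_all hl => a /=; rewrite negbK.
rewrite -leqNgt in hy; rewrite cat_rcons sorted_ltn_cat => /and4P[_ hm _ hsm] hr.
have [exy|nxy] := eqVneq x y; last first.
  by exists y, (l ++ x :: m); apply: Bump_swap => //; lia.
subst y; rewrite rcons_cat rcons_cons in hr; have {}hr := reduced_catr hr.
case: m hm hsm hr => [|z m] /=.
  by move=> _ _ /(@not_reduced_commute _ x [::]) [].
case/andP=> hz hm; rewrite (path_sortedE ltn_trans) => /andP[hzm _] hr.
have [ez|nz] := eqVneq z x.+1.
  by exists z, (l ++ [:: x, z & m]); rewrite ez; apply: Bump_keep; rewrite // -ez.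
case: (@not_reduced_commute n x (z :: m)) => //=.
apply/andP; split; first lia.
by apply: sub_all hzm => a /= h; lia.
Qed.

Lemma Bump_coexists y r' : sorted ltn r' -> reduced (y :: r') ->
  ~~ all (fun a => y < a) r' -> exists r x, Bump r x y r'.
Proof.
move=> hs hr hh.
(* Searching the reversed row finds the last entry not above [y]. *)
have hh' : has (fun a => ~~ (y < a)) (rev r') by rewrite has_rev has_predC.
have : r' = rev (rev r') by rewrite revK.
move: (rev r') hh' => q hh'.
case/split_find: hh' => x m l /= hx; rewrite -all_predC => hm.
rewrite rev_cat rev_rcons => er.
have {}hm : all (fun a => y < a) (rev m).
  by rewrite all_rev; apply: sub_all hm => a /=; rewrite negbK.
move: er hm; move: (rev m) (rev l) => {}m {}l er hm.
rewrite -leqNgt in hx; rewrite er in hs hr *; move: hs.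
rewrite sorted_ltn_cat => /and4P[hl _ hsl _].
have [exy|nxy] := eqVneq x y; last first.
  by exists (l ++ y :: m), x; apply: Bump_swap => //; lia.
subst y; rewrite -cat_cons -cat_rcons in hr; have {}hr := reduced_catl hr.
case/lastP: l {er} hl hsl hr => [|l z].
  by move=> _ _ /(@not_reduced_commute _ x [::]) [].
rewrite all_rcons -cats1 sorted_ltn_cat => /andP[hz hl] /and4P[hlz _ _ _] hr.
have [ez|nz] := eqVneq x z.+1.
  by exists (l ++ [:: z, x & m]), z; rewrite -catA /= ez; apply: Bump_keep;
    rewrite // -ez.
case: (@not_reduced_commute n x (l ++ [:: z])) => //=.
rewrite all_cat /= andbT; apply/andP; split; last by lia.
by apply: sub_all hlz => a /= h; lia.
Qed.

Lemma RowIns_nil r x r' : RowIns r x r' -> r' != [::].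
Proof.
by case=> {r x r'} [[|a r] x _|r x y r' /Bump_mem] //; case: r'.
Qed.

(** [ins_head] serves the induction on rows: the column condition with a row placed above depends on
    how the letter enters the top row of [T]. *)
Record ins_spec T x T' j : Prop := InsSpec {
  ins_tab : tab T';
  ins_reduced : reduced (row_word T');
  ins_eqv : eqv (rcons (row_word T) x) (row_word T');
  ins_shape : map size T' = incr_nth (map size T) j;
  ins_head : RowIns (head [::] T) x (head [::] T') }.

Lemma size_row_word T : size (row_word T) = sumn (map size T).
Proof.
by rewrite /row_word size_flatten /shape map_rev sumn_rev.
Qed.

Lemma sumn_incr_nth l j : sumn (incr_nth l j) = (sumn l).+1.
Proof.
elim: l j => [|a l IH] [|j] //=; last by rewrite IH addnS.
by rewrite sumn_ncons mul0n.
Qed.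

Lemma rcons_row_word r T x : rcons (row_word (r :: T)) x = row_word T ++ rcons r x.
Proof. by rewrite row_word_cons rcons_cat. Qed.

(** [p] stands for the row word of the lower rows. Reading runs from bottom to top, so the bumped
    letter lands right after [p], as the next letter to insert. *)
Lemma reduced_bump p r x y r' : Bump r x y r' -> reduced (p ++ rcons r x) ->
  eqv (p ++ rcons r x) (rcons p y ++ r') /\ reduced (rcons p y ++ r').
Proof.
move=> hb hr; have hrng : inrange n p /\ inrange n (rcons r x).
  by apply/andP; rewrite -inrange_cat; case: hr.
have [h1 h2] := Bump_eqv hb hrng.2.
have e : eqv (p ++ rcons r x) (rcons p y ++ r').
  by rewrite cat_rcons; apply: eqv_cat => //; apply: eqv_refl.
split=> //; apply: reduced_eqv e _ hr.
  by rewrite cat_rcons inrange_cat hrng.1 h1.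
by rewrite !size_cat !size_rcons (Bump_size hb) addnS addSn.
Qed.

Lemma insP T x : tab T -> reduced (rcons (row_word T) x) ->
  ins_spec T x (ins T x).1 (ins T x).2.
Proof.
elim: T x => [|r rs IH] x /=.
  move=> _ hr; split=> //=; first by apply: eqv_refl.
  exact: (@RowIns_app [::]).
case/and4P=> hr0 hrs hc ht; rewrite rcons_row_word => hr.
case: ifPn => hx.
  split=> //=.
  - rewrite -cats1 sorted_ltn_cat hx hrs /= ht andbT; apply/andP; split;
    first by case: (r).
    move/compatP: hc => [h1 h2]; apply/compatP; rewrite size_cat addn1; split;
      first lia.
    by move=> c h; rewrite nth_cat ifT; [apply: h2|lia].
  - by rewrite row_word_cons.
  - by rewrite rcons_row_word row_word_cons; apply: eqv_refl.
  - by rewrite size_rcons.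
  - exact: RowIns_app.
have [y [r' hb]] := Bump_exists hrs (reduced_catr hr) hx.
have [_ e1 e2] := Bump_compute hb; rewrite e1 e2.
have [he hrd] := reduced_bump hb hr.
have := IH y ht (reduced_catl hrd); case: (ins rs y) => rs' j /= [h1 h2 h3 h4 h6].
have he' : eqv (rcons (row_word rs) y ++ r') (row_word (r' :: rs')).
  by rewrite row_word_cons; apply: eqv_cat => //; apply: eqv_refl.
split=> //=.
- rewrite (RowIns_nil (RowIns_bump hb)) (Bump_sorted hb hrs) h1.
  by rewrite (compat_forward hrs hb h6 hc).
- apply: reduced_eqv he' _ (hrd).
    rewrite row_word_cons inrange_cat; have [-> _] := h2.
    by have [+ _] := hrd; rewrite inrange_cat => /andP[_ ->].
  by rewrite row_word_cons !size_cat size_rcons !size_row_word h4 sumn_incr_nth.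
- by rewrite rcons_row_word; apply: eqv_trans he he'.
- by rewrite h4 (Bump_size hb).
- exact: RowIns_bump hb.
Qed.

Lemma head_ins T x : tab T -> reduced (rcons (row_word T) x) ->
  x \in head [::] (ins T x).1 .
Proof.
move=> ht hr; have := ins_head (insP ht hr).
move: (head _ T) => r; case=> {T ht hr} [s y _|s y z s' /Bump_mem] //.
by rewrite mem_rcons mem_head.
Qed.

(* The hypothesis on j says that row j of T' ends in a removable corner. *)
Lemma ins_surj T' j : tab T' -> reduced (row_word T') -> j < size T' ->
  nth 0 (map size T') j.+1 < nth 0 (map size T') j ->
  exists T x, [/\ tab T, reduced (rcons (row_word T) x) & ins T x = (T', j)].
Proof.
elim: T' j => [|r' rs' IH] j //= /and4P[hr0 hrs hc ht].
rewrite row_word_cons => hr.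
case: j => [_|j hj] /= hsz.
  case/lastP: r' => [|r x] // in hr0 hrs hc hr hsz *.
  have hx : all (fun a => a < x) r.
    by move: hrs; rewrite -cats1 sorted_ltn_cat => /and4P[].
  have hrsr : sorted ltn r.
    by move: hrs; rewrite -cats1 sorted_ltn_cat => /and4P[].
  case: r => [|a r] in hr0 hrs hc hr hsz hx hrsr *.
    (* If [x] was alone in its row, the next row is shorter, hence empty, and a tableau has no empty
       rows. *)
    have ers : rs' = [::].
      by move: hsz ht; case: (rs') => [|s rs''] //=; case: s.
    by exists [::], x; rewrite ers in hr *.
  exists ((a :: r) :: rs'), x; rewrite rcons_row_word; split=> //;
    last by rewrite /= -/(all _ (a :: r)) hx.
  rewrite /= -/(sorted ltn (a :: r)) hrsr ht andbT; apply/compatP;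
    move/compatP: hc => [h1 h2].
  have e : nth 0 (map size rs') 0 = size (head [::] rs') by case: (rs').
  rewrite e size_rcons in hsz; split=> // c hcl.
  by have := h2 c hcl; rewrite nth_rcons ifT //; lia.
have [rs [y [h1 h2 h3]]] := IH j ht (reduced_catl hr) hj hsz.
have [i1 i2 i3 i4 i6] := insP h1 h2; rewrite h3 /= in i1 i2 i3 i4 i6.
have hin := head_ins h1 h2; rewrite h3 /= in hin.
have hrd : reduced (rcons (row_word rs) y ++ r').
  apply: reduced_eqv (hr).
  - rewrite inrange_cat; have [-> _] := h2.
    by have [+ _] := hr; rewrite inrange_cat => /andP[_ ->].
  - by apply: eqv_cat; [apply: eqv_sym|apply: eqv_refl].
  - by rewrite !size_cat size_rcons !size_row_word i4 sumn_incr_nth.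
have hr2 : reduced (y :: r') by move: hrd; rewrite cat_rcons => /reduced_catr.
(* [y] lies in the top row of [rs'], so the entry of [r'] above it is smaller than [y], as reverse
   bumping requires. *)
have [|r [x hb]] := Bump_coexists hrs hr2.
  move/compatP: hc => [k1 k2].
  have hi : index y (head [::] rs') < size (head [::] rs') by rewrite index_mem.
  have := k2 _ hi; rewrite nth_index // => hlt; apply/negP => hall.
  by have := nth_all hall (leq_trans hi k1); rewrite /=; lia.
exists (r :: rs), x; have hbs := Bump_sorted_inv hb hrs.
have [k1 k2 k3] := Bump_compute hb.
split.
- rewrite /= hbs h1 (compat_backward hb i6 hc) !andbT.
  by move: hr0; rewrite -!size_eq0 (Bump_size hb).
- rewrite rcons_row_word.
  have hrng : inrange n (rcons r x).
    have [+ _] := hr2; rewrite /inrange => /allP hall.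
    case: (hb) hall => {hb hc hrs hr hrd hr2 hr0 k1 k2 k3 hbs} [l m a b _ _ _|l m a
      _ _] hall;
      apply/allP => c; rewrite mem_rcons inE mem_cat ?inE => hcin; apply: hall;
      rewrite !(inE, mem_cat); move: hcin; do ![case/orP|move/eqP->|move->];
        rewrite ?eqxx ?orbT //.
  have [q1 q2] := Bump_eqv hb hrng.
  apply: reduced_eqv (hrd).
  + by rewrite inrange_cat hrng; have [+ _] := h2;
    rewrite /inrange all_rcons => /andP[_ ->].
  + by rewrite cat_rcons; apply: eqv_cat; [apply: eqv_refl|apply: eqv_sym].
  + by rewrite !size_cat !size_rcons (Bump_size hb) addnS addSn.
- by rewrite /= (negbTE k1) k2 k3 h3.
Qed.

Lemma ins_inj T1 x1 T2 x2 : tab T1 -> tab T2 ->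
  reduced (rcons (row_word T1) x1) -> reduced (rcons (row_word T2) x2) ->
  ins T1 x1 = ins T2 x2 -> T1 = T2 /\ x1 = x2.
Proof.
elim: T1 T2 x1 x2 => [|r1 s1 IH] [|r2 s2] x1 x2 /=.
- by move=> _ _ _ _ [].
- move=> _ /and4P[h2 _ _ _] _ _; case: ifP => _; last by case: ins.
  by case: r2 h2 => [|a [|b r2]].
- move=> /and4P[h2 _ _ _] _ _ _; case: ifP => _; last by case: ins.
  by case: r1 h2 => [|a [|b r2]].
case/and4P=> hn1 hs1 hc1 ht1 /and4P[hn2 hs2 hc2 ht2].
rewrite !rcons_row_word => hr1 hr2.
(* Equal row indices force both insertions to stop in this row or both to bump. *)
case: ifPn => hx1; case: ifPn => hx2; try by case: ins.
- by case=> /rcons_inj [-> ->] ->.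
have [y1 [r1' hb1]] := Bump_exists hs1 (reduced_catr hr1) hx1.
have [y2 [r2' hb2]] := Bump_exists hs2 (reduced_catr hr2) hx2.
have [_ -> ->] := Bump_compute hb1; have [_ -> ->] := Bump_compute hb2.
have [_ hd1] := reduced_bump hb1 hr1; have [_ hd2] := reduced_bump hb2 hr2.
have := IH s2 y1 y2 ht1 ht2 (reduced_catl hd1) (reduced_catl hd2).
case: ins => s1' j1; case: ins => s2' j2 H [er es ej].
have [e1 e2] : s1 = s2 /\ y1 = y2 by apply: H; rewrite es ej.
subst s2 y2; rewrite er in hb1.
by have [-> ->] := Bump_inj hb1 hb2.
Qed.

(* Row bumping lemma: rows are numbered downwards, so the box created by x' is
   weakly above the box created by x if x < x', and strictly below otherwise. *)
Lemma ins_ins T x x' : tab T -> reduced (rcons (rcons (row_word T) x) x') ->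
  let: (T', j) := ins T x in (ins T' x').2 <= j = (x < x').
Proof.
elim: T x x' => [|r rs IH] x x' /=.
  move=> _ hr; have := reduced_neq hr.
  by case: (ltngtP x x') => //=; case: ins.
case/and4P=> _ hs _ ht; rewrite rcons_row_word => hr.
have hr1 : reduced (row_word rs ++ rcons r x) by move: hr;
  rewrite -cats1 => /reduced_catl.
have hne : x != x'.
  apply: (@reduced_neq n); move: hr; rewrite rcons_cat -!cats1 -catA => /reduced_catr.
  by move/reduced_catr.
case: ifPn => hx.
  rewrite /= all_rcons; case: (ltngtP x x') hne => //= hxx _.
  - rewrite ifT //; apply: sub_all hx => a h; exact: ltn_trans h hxx.
  - by case: ins.
have [y [r' hb]] := Bump_exists hs (reduced_catr hr1) hx.
have [_ -> ->] := Bump_compute hb.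
have [he hrd] := reduced_bump hb hr1.
have hrd2 : reduced (rcons (row_word rs) y ++ rcons r' x').
  rewrite -rcons_cat; apply: reduced_eqv (hr).
  - have [+ _] := hrd; rewrite /inrange all_rcons => ->; rewrite andbT.
    by have [+ _] := hr; rewrite /inrange all_rcons => /andP[].
  - rewrite -(cats1 (_ ++ rcons r x)) -(cats1 (_ ++ r')).
    by apply: eqv_cat => //; apply: eqv_refl.
  - by rewrite !size_rcons !size_cat !size_rcons (Bump_size hb) addnS addSn.
have := IH y; case: ins => rs' j /= H.
case: ifPn => hx' /=.
  by have := allP hx' _ (Bump_mem hb) => ->.
have [y' [r'' hb']] := Bump_exists (Bump_sorted hb hs) (reduced_catr hrd2) hx'.
have [_ -> ->] := Bump_compute hb'.
case e : (ins rs' y') => [rs'' j'] /=.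
rewrite ltnS -[j'](congr1 snd e) /= H //; last first.
  by have [_ /reduced_catl] := reduced_bump hb' hrd2.
(* The induction hypothesis compares [y] and [y']; bumping preserves the order of two distinct
   letters in either direction. *)
apply/idP/idP => h.
  by case: (ltngtP x x') hne => // hxx _; have := Bump_decr hb hb' hxx; lia.
exact: Bump_incr hb hb' h.
Qed.

End Correspondence.

(** * Insertion of a whole reduced word *)

Definition eg (s : seq nat) : seq (seq nat) * seq nat :=
  foldl (fun p x => ((ins p.1 x).1, rcons p.2 (ins p.1 x).2)) ([::], [::]) s.

Lemma eg_rcons s x :
  eg (rcons s x) = ((ins (eg s).1 x).1, rcons (eg s).2 (ins (eg s).1 x).2).
Proof. by rewrite /eg foldl_rcons. Qed.

(** Lattice words: read as the rows of successively added boxes, they encode standard tableaux. *)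
Definition yamanouchi (js : seq nat) := forall s1 s2, js = s1 ++ s2 ->
  forall r r', r <= r' -> count_mem r' s1 <= count_mem r s1.

Lemma yamanouchi_rcons js j : yamanouchi (rcons js j) <->
  yamanouchi js /\ forall r r', r <= r' ->
    count_mem r' (rcons js j) <= count_mem r (rcons js j).
Proof.
split=> [h|[h1 h2] s1 s2 e].
  split=> [s1 s2 e|]; last by apply: (h _ [::]); rewrite cats0.
  by apply: (h _ (rcons s2 j)); rewrite e rcons_cat.
case/lastP: s2 e => [|s2 k]; first by rewrite cats0 => <-.
by rewrite -rcons_cat => /rcons_inj[e _]; apply: h1 e.
Qed.

Lemma tab_size_sorted T r r' : tab T -> r <= r' ->
  nth 0 (map size T) r' <= nth 0 (map size T) r.
Proof.
elim: T r r' => [|s T IH] r r' /=; first by rewrite !nth_nil.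
case/and4P=> _ _ /compatP[hs _] ht.
have h0 k : nth 0 (map size T) k <= size s.
  apply: leq_trans (IH 0 k ht (leq0n k)) _.
  by case: (T) hs.
case: r r' => [|r] [|r'] //= h; exact: IH.
Qed.

Section EdelmanGreene.
Variable n : nat.
Local Notation eqv := (eqv n).
Local Notation reduced := (reduced n).

Record eg_spec s T js : Prop := EgSpec {
  eg_tab : tab T;
  eg_reduced : reduced (row_word T);
  eg_eqv : eqv s (row_word T);
  eg_count : forall r, count_mem r js = nth 0 (map size T) r;
  eg_yamanouchi : yamanouchi js;
  eg_size : size js = size s }.

Lemma eqv_reduced_size s t : reduced s -> reduced t -> eqv s t -> size s = size t.
Proof.
move=> hs ht e; apply/eqP; rewrite eqn_leq (reduced_short hs (eqv_sym e)).
exact: reduced_short ht e.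
Qed.

Lemma reduced_rcons_eqv s t x : reduced t -> eqv s t -> reduced (rcons s x) ->
  reduced (rcons t x).
Proof.
move=> ht e h; have hs : reduced s by move: h; rewrite -cats1 => /reduced_catl.
apply: reduced_eqv (h).
- have [+ _] := h; rewrite /inrange !all_rcons => /andP[-> _].
  by have [] := ht.
- by rewrite -!cats1; apply: eqv_cat => //; apply: eqv_refl.
- by rewrite !size_rcons (eqv_reduced_size hs ht e).
Qed.

Lemma egP s : reduced s -> eg_spec s (eg s).1 (eg s).2.
Proof.
elim/last_ind: s => [|s x IH] h.
  split=> //=; first by apply: eqv_refl.
    by move=> r; rewrite nth_nil.
  by move=> [|a s1] s2.
have [h1 h2 h3 h4 h5 h6] : eg_spec s (eg s).1 (eg s).2.
  by apply: IH; move: h; rewrite -cats1 => /reduced_catl.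
have [i1 i2 i3 i4 i6] := insP h1 (reduced_rcons_eqv h2 h3 h).
have hc r : count_mem r (rcons (eg s).2 (ins (eg s).1 x).2) =
            nth 0 (map size (ins (eg s).1 x).1) r.
  by rewrite -cats1 count_cat h4 i4 nth_incr_nth /= addn0 addnC.
rewrite eg_rcons /=; split=> //.
- apply: eqv_trans i3; rewrite -!cats1; apply: eqv_cat => //; exact: eqv_refl.
- apply/yamanouchi_rcons; split=> // r r' hr; rewrite !hc; exact: tab_size_sorted.
- by rewrite !size_rcons h6.
Qed.

Lemma eg_surj js T : tab T -> reduced (row_word T) -> yamanouchi js ->
  (forall r, count_mem r js = nth 0 (map size T) r) ->
  exists s, reduced s /\ eg s = (T, js).
Proof.
elim/last_ind: js T => [|js j IH] T ht hr hy hc.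
  exists [::]; split; last first.
    case: T ht hc {hr} => // r T /=; case: r => //= a r _ /(_ 0) //=.
  exact: (@reduced_catl _ [::]) hr.
have [hy1 hy2] := (yamanouchi_rcons js j).1 hy.
have cr r : count_mem r (rcons js j) = (j == r) + count_mem r js.
  by rewrite -cats1 count_cat /= addn0 addnC.
have hj0 : 0 < nth 0 (map size T) j by rewrite -hc cr eqxx.
have hj : j < size T.
  by rewrite ltnNge; apply: contraTN hj0 => h; rewrite nth_default ?size_map.
(* The lattice condition on [js] bounds the count of [j+1] by that of [j], and the final [j] makes
   this strict: row [j] ends in a removable corner. *)
have hj1 : nth 0 (map size T) j.+1 < nth 0 (map size T) j.
  rewrite -!hc !cr eqxx eqn_leq ltnn andbF add0n add1n ltnS.
  by apply: (hy1 js [::]); rewrite ?cats0.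
have [T0 [x [h1 h2 h3]]] := ins_surj ht hr hj hj1.
have [i1 i2 i3 i4 i6] := insP h1 h2; rewrite h3 /= in i1 i2 i3 i4 i6.
have hr0 : reduced (row_word T0) by move: h2; rewrite -cats1 => /reduced_catl.
have [|s [hs es]] := IH T0 h1 hr0 hy1.
  by move=> r; move: (hc r); rewrite cr i4 nth_incr_nth => /addnI.
have := egP hs; rewrite es => -[_ _ k3 _ _ _].
exists (rcons s x); split; last by rewrite eg_rcons es /= h3.
by apply: reduced_rcons_eqv h2 => //; apply: eqv_sym.
Qed.

Lemma eg_inj s t : reduced s -> reduced t -> eg s = eg t -> s = t.
Proof.
elim/last_ind: s t => [|s x IH] t hs ht e.
  by have := eg_size (egP ht); rewrite -e => /esym/size0nil.
case/lastP: t ht e => [|t y] ht e.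
  by have := eg_size (egP hs); rewrite e size_rcons.
move: e; rewrite !eg_rcons => -[e1 /rcons_inj[e2 e3]].
have hs' : reduced s by move: hs; rewrite -cats1 => /reduced_catl.
have ht' : reduced t by move: ht; rewrite -cats1 => /reduced_catl.
have [h1 h2 h3 _ _ _] := egP hs'; have [k1 k2 k3 _ _ _] := egP ht'.
have [e4 ->] : (eg s).1 = (eg t).1 /\ x = y.
  apply: (@ins_inj n) => //; [exact: reduced_rcons_eqv hs|exact: reduced_rcons_eqv ht|].
  by move: e1 e3; case: ins => ? ?; case: ins => ? ? /= -> ->.
by rewrite (IH t hs' ht') // [eg s]surjective_pairing [eg t]surjective_pairing e2 e4.
Qed.

(** Later insertions do not alter recorded rows, so only the last two letters matter, and [ins_ins]
    applies to them. Adjacent letters are distinct, so a failed ascent is a strict descent. *)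
Lemma eg_descent s i : reduced s -> i.+1 < size s ->
  nth 0 s i != nth 0 s i.+1 /\
  (nth 0 (eg s).2 i.+1 <= nth 0 (eg s).2 i) = (nth 0 s i < nth 0 s i.+1).
Proof.
elim/last_ind: s => // s x' IH h; rewrite size_rcons ltnS => hi.
have hs : reduced s by move: h; rewrite -cats1 => /reduced_catl.
rewrite eg_rcons /= !nth_rcons (eg_size (egP hs)).
rewrite hi; case: (ltngtP i.+1 (size s)) hi => // hi _; first by apply: IH.
case/lastP: s h hs hi {IH} => // s x h hs; rewrite size_rcons => -[->].
have hs' : reduced s by move: hs; rewrite -cats1 => /reduced_catl.
have [h1 h2 h3 h4 h5 h6] := egP hs'.
rewrite nth_rcons ltnn eqxx eg_rcons /= nth_rcons h6 ltnn eqxx; split.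
  by apply: (@reduced_neq n); move: h; rewrite -!cats1 -catA => /reduced_catr.
have hr : reduced (rcons (rcons (row_word (eg s).1) x) x').
  apply: reduced_rcons_eqv h; first exact: reduced_rcons_eqv hs.
  by rewrite -!cats1; apply: eqv_cat => //; apply: eqv_refl.
by have := ins_ins h1 hr; case: ins.
Qed.

Lemma compat_trans r0 r1 r2 : compat r0 r1 -> compat r1 r2 -> compat r0 r2.
Proof.
move=> /compatP[h1 h2] /compatP[h3 h4]; apply/compatP; split; first lia.
by move=> c hc; apply: ltn_trans (h2 c _) (h4 c hc); lia.
Qed.

Lemma tab_compat r0 T i : tab (r0 :: T) -> i < size T -> compat r0 (nth [::] T i).
Proof.
elim: T r0 i => [|r1 T IH] r0 [|i] //= /and4P[_ _ hc ht] // hi.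
apply: compat_trans hc _; exact: IH.
Qed.

Lemma EG_tableauP (w : seq (Letter n)) T : EG_tableau w T <-> tab T /\ reduced_for
  w (row_word T).
Proof.
have hin : inrange n (row_word T) = all (fun row => all (fun a => 1 <= a <= n) row) T.
  rewrite /row_word /inrange -[RHS]all_rev.
  by elim: (rev T) => //= r s IH; rewrite all_cat IH.
split=> [[h1 [h2 [h3 [h4 [h5 h6]]]]]|[ht [h1 h2]]].
  split; last by split; [rewrite hin|].
  elim: T h1 h2 h4 h5 {h3 h6 hin} => [|r T IH] //= /andP[hr h1] h2 /andP[h3 h4] h5.
  rewrite h3 -size_eq0 hr IH //=; last 2 first.
  - exact: path_sorted h2.
  - by move=> i j c hij; apply: (h5 i.+1 j.+1).
  rewrite andbT; apply/compatP; case: T h2 h5 {IH h1 h4} => [|r1 T] //= /andP[h2 _] h5.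
  by split=> // c; apply: (h5 0 1).
split.
  by elim: T ht {h1 h2 hin} => //= r T IH /and4P[+ _ _ /IH->]; rewrite -size_eq0 => ->.
split.
  rewrite /sh; elim: T ht {h1 h2 hin} => //= r T IH /and4P[_ _ /compatP[hc _] ht].
  by have := IH ht; case: (T) hc => //= r1 T' -> ->.
split; first by rewrite -hin.
split.
  by elim: T ht {h1 h2 hin} => //= r T IH /and4P[_ -> _ /IH->].
split=> // i j c hij hc.
elim: T i j hij hc ht {h1 h2 hin} => [|r T IH] [|i] [|j] //= hij hc.
  move=> ht; have hj : j < size T by rewrite ltnNge; apply: contraTN hc => h;
    rewrite [nth _ T j]nth_default.
  by have /compatP[_] := tab_compat ht hj; apply.
by case/and4P=> _ _ _; apply: IH.
Qed.

Lemma eg_EG (w : seq (Letter n)) s : reduced_for w s -> EG_tableau w (eg s).1.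
Proof.
move=> h; have hs := reduced_for_reduced h; have [h1 h2 h3 _ _ _] := egP hs.
apply/EG_tableauP; split=> //; apply: reduced_for_eqv (h3) _ h; first by case: h2.
by rewrite (eqv_reduced_size hs h2 h3).
Qed.

Lemma eg_EG_surj (w : seq (Letter n)) T js : EG_tableau w T -> yamanouchi js ->
  (forall r, count_mem r js = nth 0 (map size T) r) ->
  exists2 s, reduced_for w s & eg s = (T, js).
Proof.
case/EG_tableauP=> ht hw hy hc; have hr := reduced_for_reduced hw.
have [s [hs es]] := eg_surj ht hr hy hc; exists s => //.
have := egP hs; rewrite es => -[_ _ k3 _ _ _].
apply: reduced_for_eqv (eqv_sym k3) _ (hw); first by case: hs.
by rewrite (eqv_reduced_size hs hr k3).
Qed.

End EdelmanGreene.

(** * Recording sequences and primed tableaux *)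

(* A biletter (v, a) is a letter a lying in the v-th block, and a pair (v, j) a
   box of row j with entry v.  Even v stand for primed entries: their letters
   decrease and their boxes are filled downwards, as a vertical strip; for odd v
   letters increase and boxes are filled upwards, as a horizontal strip. *)
Definition letter_lt (p q : nat * nat) := (p.1 < q.1) ||
  (p.1 == q.1) && (if odd p.1 then p.2 < q.2 else q.2 < p.2).

Definition box_lt (p q : nat * nat) := (p.1 < q.1) ||
  (p.1 == q.1) && (if odd p.1 then q.2 <= p.2 else p.2 < q.2).

Lemma letter_lt_trans : transitive letter_lt.
Proof.
move=> [b y] [a x] [c z]; rewrite /letter_lt /=.
have : a = b -> odd a = odd b by move->.
by case: (odd a); case: (odd b); lia.
Qed.

Lemma letter_lt_irr : irreflexive letter_lt.
Proof. by move=> p; rewrite /letter_lt !ltnn eqxx if_same. Qed.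

Lemma box_lt_trans : transitive box_lt.
Proof.
move=> [b y] [a x] [c z]; rewrite /box_lt /=.
have : a = b -> odd a = odd b by move->.
by case: (odd a); case: (odd b); lia.
Qed.

Lemma box_lt_anti : antisymmetric box_lt.
Proof.
move=> [a x] [b y]; rewrite /box_lt /=; case: (ltngtP a b) => //= ->.
by case: ifP => _ ?; congr (_, _); lia.
Qed.

Lemma biword_sorted n v s : reduced n s -> size v = size s ->
  sorted letter_lt (zip v s) = sorted box_lt (zip v (eg s).2).
Proof.
move=> hs hv; have hj := eg_size (egP hs).
have e i : i.+1 < size s ->
    letter_lt (nth (0, 0) (zip v s) i) (nth (0, 0) (zip v s) i.+1) =
    box_lt (nth (0, 0) (zip v (eg s).2) i) (nth (0, 0) (zip v (eg s).2) i.+1).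
  move=> hi; rewrite !nth_zip ?hj //; have [h1 h2] := eg_descent hs hi.
  rewrite /letter_lt /box_lt /= h2; case: ltngtP => //= _; case: ifP => // _.
  by rewrite [RHS]ltnNge h2 -leqNgt [RHS]leq_eqVlt eq_sym (negbTE h1).
apply/(sortedP (0, 0))/(sortedP (0, 0)) => h i; rewrite size_zip hv ?hj minnn => hi.
  by rewrite -e // h // size_zip hv minnn.
by rewrite e // h // size_zip hv hj minnn.
Qed.

Definition rowvals (J : seq (nat * nat)) r := [seq p.1 | p <- J & p.2 == r].

Lemma size_rowvals J r : size (rowvals J r) = count_mem r (unzip2 J).
Proof. by rewrite size_map size_filter count_map. Qed.

Lemma rowvals_cat J1 J2 r : rowvals (J1 ++ J2) r = rowvals J1 r ++ rowvals J2 r.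
Proof. by rewrite /rowvals filter_cat map_cat. Qed.

Lemma mem_rowvals J r v : (v \in rowvals J r) = ((v, r) \in J).
Proof.
apply/mapP/idP => [[[a b]]|h]; last by exists (v, r); rewrite // mem_filter eqxx.
by rewrite mem_filter /= => /andP[/eqP-> h] ->.
Qed.

Lemma count_rowvals J p : count_mem p.1 (rowvals J p.2) = count_mem p J.
Proof.
rewrite count_map count_filter; apply: eq_count => -[a b] /=.
by case: p => c d; rewrite xpair_eqE.
Qed.

Lemma rowvals_split J r c : c < size (rowvals J r) -> exists J1 J2,
  J = J1 ++ (nth 0 (rowvals J r) c, r) :: J2 /\ size (rowvals J1 r) = c.
Proof.
elim: J c => // -[a b] J IH c; rewrite /rowvals /=.
have [->|hb] := eqVneq b r; last first.
  move/IH=> [J1 [J2 [e1 e2]]]; exists ((a, b) :: J1), J2; split; first by rewrite {1}e1.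
  by rewrite /rowvals /= (negbTE hb).
case: c => [_|c]; first by exists [::], J.
move/IH=> [J1 [J2 [e1 e2]]]; exists ((a, r) :: J1), J2; split; first by rewrite {1}e1.
by rewrite /rowvals /= eqxx /= -e2.
Qed.

Lemma rowvals_lt J r c c' : sorted box_lt J -> c < c' -> c' < size (rowvals J r) ->
  let v := nth 0 (rowvals J r) c in let v' := nth 0 (rowvals J r) c' in
  v <= v' /\ (v = v' -> odd v).
Proof.
move=> hJ hcc; rewrite size_map => hc' v v'.
have hs : sorted box_lt [seq p <- J | p.2 == r] by apply: sorted_filter => //;
  apply: box_lt_trans.
have hc := ltn_trans hcc hc'.
have := sorted_ltn_nth box_lt_trans (0, 0) hs c c' hc hc' hcc.
have ha : all (fun p : nat * nat =>
  p.2 == r) [seq p <- J | p.2 == r] by apply: filter_all.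
rewrite {}/v {}/v' !(nth_map (0, 0)) // /box_lt.
have /eqP-> := allP ha _ (mem_nth (0, 0) hc).
have /eqP-> := allP ha _ (mem_nth (0, 0) hc').
move: (_.1) (nth _ _ c').1 => a b.
by rewrite leqnn ltnn; case: (odd a) => h; split=> //; lia.
Qed.

(** * Recording sequences as fillings of a shape *)

Section Filling.
Variables (k : nat) (lam : seq nat).
Hypothesis lam_sorted : forall r r', r <= r' -> nth 0 lam r' <= nth 0 lam r.

Record is_recording J : Prop := IsRecording {
  is_recording_sorted : sorted box_lt J;
  is_recording_bound : all (fun p => p.1 < k.*2) J;
  is_recording_yamanouchi : yamanouchi (unzip2 J);
  is_recording_count : forall r, count_mem r (unzip2 J) = nth 0 lam r }.

(* The c-th occurrence of the row index r in J carries the entry in box (r, c). *)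
Definition filling_of J : filling k lam :=
  [ffun p : 'I_(size lam) * 'I_(ncols lam) => obind insub (onth (rowvals J p.1) p.2)].

Lemma onth_some (s : seq nat) c v : onth s c = Some v <-> c < size s /\ nth 0 s c = v.
Proof.
split=> [h|[h1 h2]]; first by rewrite -onthTE h (@onth_nth _ 0 _ _ _ h).
by have := odflt_onth 0 s c; rewrite h2; have := onthTE s c; rewrite h1;
  case: (onth s c) => //= a _ ->.
Qed.

Lemma filling_ofE J (p : 'I_(size lam) * 'I_(ncols lam)) : is_recording J ->
  omap val (filling_of J p) = onth (rowvals J p.1) p.2.
Proof.
case=> _ hb _ _; rewrite ffunE; case e : onth => [v|] //=.
have [hc hv] := (onth_some _ _ _).1 e.
have hin : (v, val p.1) \in J by rewrite -mem_rowvals -hv mem_nth.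
by rewrite insubT //; apply: (allP hb _ hin).
Qed.

Lemma filling_of_some J (p : 'I_(size lam) * 'I_(ncols lam)) v : is_recording J ->
  filling_of J p = Some v ->
  p.2 < size (rowvals J p.1) /\ nth 0 (rowvals J p.1) p.2 = v.
Proof. by move=> hJ h; apply/onth_some; rewrite -filling_ofE // h. Qed.

Lemma is_recording_size J r : is_recording J -> size (rowvals J r) = nth 0 lam r.
Proof. by move=> hJ; rewrite size_rowvals is_recording_count. Qed.

(** When box [(r', c)] is added, the lattice condition on that prefix gives row [r] more than [c]
    boxes already; so [(r, c)] comes earlier in [J], and [box_lt] compares the entries. *)
Lemma rowvals_col J r r' c : is_recording J -> r < r' -> c < size (rowvals J r') ->
  let v := nth 0 (rowvals J r) c in let v' := nth 0 (rowvals J r') c in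
  v <= v' /\ (v = v' -> ~~ odd v).
Proof.
move=> hJ hr hc v v'.
have [J1 [J2 [eJ hc1]]] := rowvals_split hc.
have hpre : count_mem r' (unzip2 (J1 ++ [:: (v', r')])) <=
            count_mem r (unzip2 (J1 ++ [:: (v', r')])).
  apply: (is_recording_yamanouchi hJ (s2 := unzip2 J2)); last exact: ltnW.
  by rewrite -map_cat -catA /= eJ.
rewrite -!size_rowvals !rowvals_cat !size_cat hc1 /= in hpre.
rewrite {1 3}/rowvals /= eqxx (gtn_eqF hr) /= addn0 addn1 in hpre.
have hv : (v, r) \in J1.
  rewrite -mem_rowvals /v eJ rowvals_cat nth_cat hpre; exact: mem_nth.
have hle : box_lt (v, r) (v', r').
  have := is_recording_sorted hJ;
    rewrite eJ (sorted_pairwise box_lt_trans) pairwise_cat.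
  by case/and3P=> /allrelP h _ _; apply: h => //; rewrite mem_head.
move: hle hr; rewrite /box_lt /=; move: v v' {hv hpre eJ} => v v'.
by case: (odd v) => hle hr; split=> //; lia.
Qed.

Lemma filling_of_primed J : is_recording J -> primed_tableau [::] (filling_of J).
Proof.
move=> hJ; split.
  move=> p; rewrite /in_skew nth_nil ltn_ord /= -(is_recording_size _ hJ) -onthTE
    -(filling_ofE _ hJ).
  by case: (filling_of J p).
split.
  move=> r c c' v v' hc /(filling_of_some hJ) /= [_ <-] /(filling_of_some hJ) /= [h <-].
  by have [] := rowvals_lt (is_recording_sorted hJ) hc h.
split.
  move=> r r' c v v' hr /(filling_of_some hJ) /= [_ <-] /(filling_of_some hJ) /= [h <-].
  by have [] := rowvals_col hJ hr h.
split.
  move=> r c c' v; rewrite neq_ltn => /orP hcc /(filling_of_some hJ) /= [h1 h2].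
  move=> /(filling_of_some hJ) /= [h3 h4].
  case: hcc => hcc.
    have [_] := rowvals_lt (is_recording_sorted hJ) hcc h3; rewrite h2 h4; exact.
  have [_] := rowvals_lt (is_recording_sorted hJ) hcc h1; rewrite h2 h4; exact.
move=> r r' c v; rewrite neq_ltn => /orP hcc /(filling_of_some hJ) /= [h1 h2].
move=> /(filling_of_some hJ) /= [h3 h4].
case: hcc => hcc.
  have [_] := rowvals_col hJ hcc h3; rewrite h2 h4; exact.
have [_] := rowvals_col hJ hcc h1; rewrite h2 h4; exact.
Qed.

Lemma leq_ncols r : nth 0 lam r <= ncols lam.
Proof.
case: (ltnP r (size lam)) => h; last by rewrite nth_default.
by rewrite /ncols; apply: (@leq_bigmax_seq _ _ predT id) => //; apply: mem_nth.
Qed.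

Lemma rowvals_inj J J' : sorted box_lt J -> sorted box_lt J' ->
  (forall r, rowvals J r = rowvals J' r) -> J = J'.
Proof.
move=> h1 h2 h; apply: (sorted_eq box_lt_trans box_lt_anti h1 h2).
by apply/allP => p _; rewrite /= -!count_rowvals h.
Qed.

Lemma filling_of_inj J J' : is_recording J -> is_recording J' ->
  filling_of J = filling_of J' -> J = J'.
Proof.
move=> hJ hJ' e; apply: rowvals_inj (is_recording_sorted hJ) (is_recording_sorted
  hJ') _ => r.
apply: eq_from_onth => c.
case: (ltnP c (nth 0 lam r)) => hc; last by rewrite !onth_default ?is_recording_size.
have hr : r < size lam by rewrite ltnNge; apply: contraTN hc => h; rewrite nth_default.
have hc' := leq_trans hc (leq_ncols r).
have := filling_ofE (Ordinal hr, Ordinal hc') hJ.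
by have := filling_ofE (Ordinal hr, Ordinal hc') hJ'; rewrite e /= => -> ->.
Qed.

Lemma sum_onth (s : seq nat) m u : size s <= m ->
  \sum_(c < m) (onth s c == Some u) = count_mem u s.
Proof.
elim: s m => [|a s IH] m hm; first by rewrite big1 // => i _; rewrite onth0n.
case: m hm => // m hm; rewrite big_ord_recl /= IH //.
Qed.

Lemma sum_rowvals J m u : all (fun p => p.2 < m) J ->
  \sum_(r < m) count_mem u (rowvals J r) = count_mem u (unzip1 J).
Proof.
elim: J => [|[a b] J IH] /=; first by rewrite big1.
case/andP=> hb hJ; rewrite -IH // (bigD1 (Ordinal hb)) //= [in RHS](bigD1 (Ordinal
  hb)) //=.
rewrite /rowvals /= eqxx /= addnA; congr (_ + _).
apply: eq_bigr => i; rewrite -val_eqE /= eq_sym => /negbTE-> //.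
Qed.

Lemma filling_of_weight J u : is_recording J ->
  #|[set p | if filling_of J p is Some v then v == u :> nat else false]| =
  count_mem u (unzip1 J).
Proof.
move=> hJ; rewrite -sum1_card big_mkcond /=.
rewrite (eq_bigr (fun p : 'I_(size lam) * 'I_(ncols lam) =>
    (onth (rowvals J p.1) p.2 == Some u) : nat)); last first.
  by move=> p _; rewrite inE -(filling_ofE _ hJ); case: (filling_of J p) => //= v;
    rewrite (inj_eq Some_inj); case: eqP.
rewrite -(pair_bigA _ (fun (r : 'I_(size lam)) (c : 'I_(ncols lam)) =>
    (onth (rowvals J r) c == Some u) : nat)) /=.
rewrite -(@sum_rowvals J (size lam)); last first.
  apply/allP => -[a b] hab /=; rewrite ltnNge; apply/negP => hb.
  have : 0 < nth 0 lam b by rewrite -(is_recording_count hJ) -has_count has_pred1;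
    apply/mapP; exists (a, b).
  by rewrite nth_default.
by apply: eq_bigr => r _; apply: sum_onth; rewrite is_recording_size // leq_ncols.
Qed.

(** * Reading a recording sequence off a primed tableau *)

Section Surjective.
Variable T : filling k lam.
Hypothesis hT : primed_tableau [::] T.

Definition entry r c : nat :=
  if insub r is Some r' then if insub c is Some c' then
    if T (r', c') is Some v then val v else 0 else 0 else 0.

Lemma entryE r c : c < nth 0 lam r ->
  exists (r' : 'I_(size lam)) (c' : 'I_(ncols lam)) v,
  [/\ val r' = r, val c' = c, T (r', c') = Some v & val v = entry r c].
Proof.
move=> hc.
have hr : r < size lam by rewrite ltnNge; apply: contraTN hc => h; rewrite nth_default.
have hc' := leq_trans hc (leq_ncols r).
have [h _] := hT; have := h (Ordinal hr, Ordinal hc').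
rewrite /in_skew nth_nil hr hc /=; case e : (T _) => [v|] // _.
exists (Ordinal hr), (Ordinal hc'), v; split=> //.
by rewrite /entry !insubT e.
Qed.

Lemma entry_row r c c' : c < c' -> c' < nth 0 lam r ->
  entry r c <= entry r c' /\ (entry r c = entry r c' -> odd (entry r c)).
Proof.
move=> hcc hc'; have hc := ltn_trans hcc hc'.
have [r1 [c1 [v1 [er1 ec1 e1 <-]]]] := entryE hc.
have [r2 [c2 [v2 [er2 ec2 e2 <-]]]] := entryE hc'.
have er : r2 = r1 by apply: val_inj; rewrite er1.
rewrite er in e2; have [_ [h1 [_ [h3 _]]]] := hT.
have h12 : c1 < c2 by rewrite ec1 ec2.
split; first exact: h1 e1 e2.
move=> /val_inj e; apply: (h3 r1 c1 c2) => //; last by rewrite e.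
by rewrite neq_ltn h12.
Qed.

Lemma entry_col r r' c : r < r' -> c < nth 0 lam r' ->
  entry r c <= entry r' c /\ (entry r c = entry r' c -> ~~ odd (entry r c)).
Proof.
move=> hrr hc'; have hc := leq_trans hc' (lam_sorted (ltnW hrr)).
have [r1 [c1 [v1 [er1 ec1 e1 <-]]]] := entryE hc.
have [r2 [c2 [v2 [er2 ec2 e2 <-]]]] := entryE hc'.
have er : c2 = c1 by apply: val_inj; rewrite ec1.
rewrite er in e2; have [_ [_ [h1 [_ h3]]]] := hT.
have h12 : r1 < r2 by rewrite er1 er2.
split; first exact: h1 e1 e2.
move=> /val_inj e; apply: (h3 r1 r2 c1) => //; last by rewrite e.
by rewrite neq_ltn h12.
Qed.

(** [sort] needs a total relation, so [box_lt] is relaxed on equal pairs; [recording_of_sorted]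
    regains strictness. *)
Definition box_le (p q : nat * nat) := (p.1 < q.1) ||
  (p.1 == q.1) && (if odd p.1 then q.2 <= p.2 else p.2 <= q.2).

Lemma box_le_total : total box_le.
Proof.
move=> [a x] [b y]; rewrite /box_le /=; case: (ltngtP a b) => //= ->.
by case: ifP => _; apply: leq_total.
Qed.

Lemma box_le_trans : transitive box_le.
Proof.
move=> [b y] [a x] [c z]; rewrite /box_le /=.
have : a = b -> odd a = odd b by move->.
by case: (odd a); case: (odd b); lia.
Qed.

Definition row_of r := [seq entry r c | c <- iota 0 (nth 0 lam r)].
Definition boxes := flatten [seq [seq (v, r) | v <- row_of r] | r <- iota 0 (size lam)].
Definition recording_of := sort box_le boxes.

Lemma rowvals_boxes r : rowvals boxes r = row_of r.
Proof.
have main m : rowvals (flatten [seq [seq (v, r) | v <- row_of r] | r <- iota 0 m]) r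
    = if r < m then row_of r else [::].
  elim: m => // m IH; rewrite -addn1 iotaD map_cat flatten_cat rowvals_cat IH /= cats0.
  have -> : rowvals [seq (v, m) | v <- row_of m] r = if m == r then row_of m else [::].
    elim: (row_of m) => [|v s IHs]; first by rewrite if_same.
    by move: IHs; rewrite /rowvals /=; case: eqP => //= _ ->.
  by rewrite addn1 ltnS; case: ltngtP => // [|->]; rewrite ?cats0.
by rewrite main; case: ltnP => // h; rewrite /row_of nth_default.
Qed.

Lemma rowvals_recording_of r : rowvals recording_of r = row_of r.
Proof.
apply: (sorted_eq leq_trans anti_leq).
- rewrite sorted_map; apply: (@sub_sorted _ box_le).
    by move=> [a x] [b y] /=; rewrite /box_le /=; lia.
  by apply: sorted_filter; [exact: box_le_trans|apply: sort_sorted box_le_total _].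
- apply/(sortedP 0) => i; rewrite size_map size_iota => hi.
  rewrite !(nth_map 0) ?size_iota //; last exact: ltnW.
  by rewrite !nth_iota ?add0n //; [case: (entry_row (ltnSn i) hi)|exact: ltnW].
by rewrite -rowvals_boxes; apply: perm_map; apply: perm_filter; rewrite perm_sort.
Qed.

Lemma nth_row_of r c : c < nth 0 lam r -> nth 0 (row_of r) c = entry r c.
Proof. by move=> h; rewrite (nth_map 0) ?size_iota // nth_iota. Qed.

Lemma size_row_of r : size (row_of r) = nth 0 lam r.
Proof. by rewrite size_map size_iota. Qed.

Lemma recording_of_sorted_le : sorted box_le recording_of.
Proof. exact: sort_sorted box_le_total _. Qed.

(** Equal neighbours with an even value would be one primed entry occurring twice in a row. *)
Lemma recording_of_sorted : sorted box_lt recording_of.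
Proof.
apply/(sortedP (0, 0)) => i hi.
have := (sortedP (0, 0) recording_of_sorted_le) i hi.
have ed : recording_of = take i recording_of ++ nth (0, 0) recording_of i :: nth
  (0, 0) recording_of i.+1 :: drop i.+2 recording_of.
  by rewrite -!drop_nth ?cat_take_drop // ltnW.
move: ed; move: (nth _ _ _) (nth _ _ _) => [a x] [b y] ed.
rewrite /box_le /box_lt /=; case: ltngtP => //= eab; case: ifP => // ho hle.
rewrite ltn_neqAle hle andbT; apply/eqP => exy; subst b y.
have := rowvals_recording_of x; rewrite ed rowvals_cat {2}/rowvals /= eqxx /= => er.
have hs : (size (rowvals (take i recording_of) x)).+1 < nth 0 lam x.
  by rewrite -size_row_of -er size_cat /=; lia.
have [_] := entry_row (ltnSn _) hs.
rewrite -!nth_row_of ?(ltnW hs) // -er !nth_cat ltnn subnn ltnNge leqnSn /= subSnn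
  /= ho.
by move/(_ erefl).
Qed.

Lemma recording_of_count r : count_mem r (unzip2 recording_of) = nth 0 lam r.
Proof. by rewrite -size_rowvals rowvals_recording_of size_row_of. Qed.

(** If a prefix had more boxes in row [r'] than its [c] boxes in row [r < r'], it would contain
    [(r', c)] but not [(r, c)], although the column conditions put [(r, c)] first. *)
Lemma recording_of_yamanouchi : yamanouchi (unzip2 recording_of).
Proof.
move=> s1 s2 es r r'; rewrite leq_eqVlt => /orP[/eqP->//|hr].
rewrite leqNgt; apply/negP => hc.
set m := size s1.
have e1 : s1 = unzip2 (take m recording_of)
  by rewrite /unzip2 map_take -/unzip2 es take_size_cat.
rewrite e1 -!size_rowvals in hc; set c := size _ in hc.
have eJ := esym (cat_take_drop m recording_of).
have hc1 : c < nth 0 lam r'.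
  by rewrite -size_row_of -rowvals_recording_of {1}eJ rowvals_cat size_cat; lia.
have hc2 := leq_trans hc1 (lam_sorted (ltnW hr)).
have [k1 k2] := entry_col hr hc1.
have h1 : (entry r' c, r') \in take m recording_of.
  rewrite -mem_rowvals -nth_row_of // -rowvals_recording_of {1}eJ rowvals_cat
    nth_cat hc.
  exact: mem_nth.
have h2 : (entry r c, r) \in drop m recording_of.
  rewrite -mem_rowvals -nth_row_of // -rowvals_recording_of {1}eJ rowvals_cat
    nth_cat -/c ltnn subnn.
  apply: mem_nth; move: hc2;
    rewrite -size_row_of -rowvals_recording_of {1}eJ rowvals_cat size_cat -/c.
  by rewrite -{1}[c]addn0 ltn_add2l.
have := recording_of_sorted_le; rewrite eJ (sorted_pairwise box_le_trans) pairwise_cat.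
case/and3P=> /allrelP /(_ _ _ h1 h2) + _ _; rewrite /box_le /=.
case: ltngtP k1 k2 => //= <- _ /(_ erefl) /negbTE ->.
by rewrite leqNgt hr.
Qed.

Lemma recording_of_ok : is_recording recording_of.
Proof.
split; [exact: recording_of_sorted| |exact: recording_of_yamanouchi|exact:
  recording_of_count].
apply/allP => -[v r] h /=; move: h; rewrite -mem_rowvals rowvals_recording_of.
case/mapP=> c; rewrite mem_iota add0n => hc ->.
have [r1 [c1 [v1 [_ _ _ <-]]]] := entryE hc; exact: ltn_ord.
Qed.

Lemma recording_ofK : filling_of recording_of = T.
Proof.
apply/ffunP => -[r c].
have : omap val (filling_of recording_of (r, c)) = omap val (T (r, c)).
  rewrite filling_ofE; last exact: recording_of_ok.
  rewrite rowvals_recording_of /=; case: (ltnP c (nth 0 lam r)) => hc.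
    have [r1 [c1 [v1 [/val_inj-> /val_inj-> -> /= e]]]] := entryE hc.
    by apply/onth_some; rewrite size_row_of nth_row_of.
  rewrite onth_default ?size_row_of //; have [h _] := hT; have := h (r, c).
  by rewrite /in_skew /= [c < _]ltnNge hc andbF => /eqP ->.
by case: (filling_of _ _) => [a|]; case: (T _) => [b|] //= [] /val_inj ->.
Qed.

End Surjective.

Lemma filling_of_surj (T : filling k lam) : primed_tableau [::] T ->
  exists2 J, is_recording J & filling_of J = T.
Proof. by move=> hT; exists (recording_of T);
  [apply: recording_of_ok|apply: recording_ofK]. Qed.

End Filling.

(** * Block divisions *)

Section Blocks.
Variables (n k : nat).
Implicit Types (B : {ffun 'I_k -> {set Letter n}}) (p : 'I_k * Letter n).

(* Negative letters of block i get the value 2i, which encodes the primed entry,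
   and the others the value 2i+1. *)
Definition enc p : nat * nat :=
  (if p.2 < n then p.1.*2 else p.1.*2.+1, absn p.2).

Definition block_pairs B : seq ('I_k * Letter n) :=
  flatten [seq [seq (i, l) | l <- enum (B i)] | i <- enum 'I_k].

Definition biword B := map enc (block_pairs B).

Lemma mem_block_pairs B p : (p \in block_pairs B) = (p.2 \in B p.1).
Proof.
apply/flattenP/idP => [[s /mapP[i _ ->] /mapP[l]]|h].
  by rewrite mem_enum => hl ->.
exists [seq (p.1, l) | l <- enum (B p.1)]; first by apply: map_f; rewrite mem_enum.
by apply/mapP; exists p.2; rewrite ?mem_enum //; case: (p).
Qed.

Lemma snd_block_pairs B : map snd (block_pairs B) = block_word B.
Proof.
rewrite map_flatten -map_comp; congr flatten; apply: eq_map => i /=.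
by rewrite -map_comp map_id.
Qed.

Lemma biword_snd B : unzip2 (biword B) = map (@absn n) (block_word B).
Proof. by rewrite -snd_block_pairs /unzip2 -!map_comp. Qed.

Lemma enc_inj : injective enc.
Proof.
move=> [i l] [j m]; rewrite /enc /= /absn => -[e1 e2].
have [e3 e4] : i = j :> nat /\ l = m :> nat by move: e1 e2; do 2!case: ifP; lia.
by rewrite (val_inj e3) (val_inj e4).
Qed.

(** [absn] reverses the order of negative indices, matching the decreasing order of [letter_lt] at
    even values. *)
Lemma enc_lt (i j : 'I_k) (l m : Letter n) :
  (i < j) || (i == j) && (l < m) -> letter_lt (enc (i, l)) (enc (j, m)).
Proof.
rewrite /letter_lt /enc /absn /= => /orP[h|/andP[/eqP <- h]].
  by apply/orP; left; do 2!case: ifP; lia.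
by do 2!case: ifP => ? //=; rewrite ?odd_double ?ltnS ?ltnn ?eqxx /=; lia.
Qed.

Lemma enum_ltn (m : nat) (A : {set 'I_m}) : pairwise (fun i j : 'I_m => i < j) (enum A).
Proof.
have tr : transitive (fun i j : 'I_m => i < j) by move=> a b c; apply: ltn_trans.
rewrite -(sorted_pairwise tr) /enum_mem; apply: sorted_filter => //.
by have := iota_ltn_sorted 0 m; rewrite -val_enum_ord sorted_map enumT.
Qed.

Lemma sorted_biword B : sorted letter_lt (biword B).
Proof.
rewrite (sorted_pairwise letter_lt_trans) /biword pairwise_map /block_pairs.
have := enum_ltn [set: 'I_k]; rewrite (eq_enum (in_set xpredT)).
elim: (enum _) => //= i s IH /andP[hi hs].
rewrite pairwise_cat IH // andbT; apply/andP; split.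
  apply/allrelP => p q /mapP[l _ ->] /flattenP[t /mapP[j hj ->]] /mapP[m _ ->].
  by apply: enc_lt; rewrite (allP hi _ hj).
rewrite pairwise_map; apply: sub_pairwise (enum_ltn (B i)) => l m h.
by apply: enc_lt; rewrite eqxx h orbT.
Qed.

Lemma biword_inj : injective biword.
Proof.
move=> B B' e; apply/ffunP => i; apply/setP => l.
have h (C : {ffun 'I_k -> {set Letter n}}) : (l \in C i) = (enc (i, l) \in biword C).
  by rewrite mem_map ?mem_block_pairs //; apply: enc_inj.
by rewrite !h e.
Qed.

(** A strictly sorted list is determined by its members, so it suffices that the blocks contain the
    letters prescribed by [J]. *)
Lemma biword_surj J : sorted letter_lt J -> all (fun q => q.1 < k.*2) J ->
  all (fun q => 1 <= q.2 <= n) J -> exists B, biword B = J.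
Proof.
move=> hJ h1 h2; exists [ffun i => [set l | enc (i, l) \in J]].
apply: (irr_sorted_eq letter_lt_trans letter_lt_irr) => // [|q];
  first exact: sorted_biword.
apply/mapP/idP => [[[i l]]|]; first by rewrite mem_block_pairs ffunE inE => h ->.
case: q => v a hq.
have hv : v < k.*2 := allP h1 _ hq; have ha : 1 <= a <= n := allP h2 _ hq.
have hi : v./2 < k by lia.
(* The parity of [v] restores the sign of the letter; as [a >= 1], the index [n - a] is read as
   negative. *)
have hl : (if odd v then n + a else n - a) < n.*2.+1 by case: ifP; lia.
have eq : enc (Ordinal hi, Ordinal hl) = (v, a).
  rewrite /enc /absn /=; have := odd_double_half v.
  by case ho: (odd v) hl => hl /=; case: ifP => hh hv'; congr (_, _); lia.
by exists (Ordinal hi, Ordinal hl); rewrite ?mem_block_pairs ?ffunE ?inE /= eq.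
Qed.

Lemma biword_bound B : all (fun q => q.1 < k.*2) (biword B).
Proof.
apply/allP => q /mapP[[i l] _ ->]; rewrite /enc /=.
by have := ltn_ord i; case: ifP; lia.
Qed.

Lemma count_block B (i : 'I_k) (a : pred ('I_k * Letter n)) :
  (forall p, a p -> p.1 = i) ->
  count a (block_pairs B) = #|[set l in B i | a (i, l)]|.
Proof.
move=> ha; rewrite /block_pairs count_flatten -map_comp sumnE big_map big_enum /=.
rewrite (bigD1 i) //= big1 ?addn0; last first.
  move=> j hj; rewrite count_map -(count_pred0 (enum (B j))); apply: eq_count => l /=.
  by apply/negP => /ha /= e; rewrite e eqxx in hj.
rewrite count_map -size_filter cardE; congr size.
rewrite {1}/enum_mem -filter_predI /enum_mem; apply: eq_filter => l /=.
by rewrite !inE andbC.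
Qed.

Lemma dw1E B (i : 'I_k) : dw1 B i = count_mem i.*2 (unzip1 (biword B)).
Proof.
rewrite /dw1 /unzip1 /biword -map_comp count_map (count_block B (i := i)).
  by apply: eq_card => l; rewrite !inE /= /enc /=; case: ifP; case: (l \in _); lia.
move=> [j l] /=; rewrite /enc /= => h; apply: val_inj => /=.
by move: h; case: ifP => _; lia.
Qed.

Lemma dw2E B (i : 'I_k) : dw2 B i = count_mem i.*2.+1 (unzip1 (biword B)).
Proof.
rewrite /dw2 /unzip1 /biword -map_comp count_map (count_block B (i := i)).
  by apply: eq_card => l; rewrite !inE /= /enc /=; case: ifP; case: (l \in _); lia.
move=> [j l] /=; rewrite /enc /= => h; apply: val_inj => /=.
by move: h; case: ifP => _; lia.
Qed.

End Blocks.

(** * Finiteness of the set of Edelman-Greene tableaux *)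

Fixpoint bounded_seqs (T : Type) (A : seq T) m : seq (seq T) :=
  if m is m'.+1 then [::] :: [seq a :: s | a <- A, s <- bounded_seqs A m'] else [::
    [::]].

Lemma mem_bounded_seqs (T : eqType) (A : seq T) m (s : seq T) :
  size s <= m -> all (fun a => a \in A) s -> s \in bounded_seqs A m.
Proof.
elim: m s => [|m IH] [|a s] //= hm /andP[ha hs].
by rewrite inE /=; apply/allpairsP; exists (a, s); rewrite ha IH.
Qed.

(** The reading word is no longer than [w], which bounds the number of rows and their lengths; the
    entries lie between 1 and [n]. *)
Lemma EG_finite n (w : seq (Letter n)) :
  exists ts : seq (seq (seq nat)), uniq ts /\ forall t, t \in ts <-> EG_tableau w t.
Proof.
exists (undup [seq t <- bounded_seqs (bounded_seqs (iota 1 n) (size w)) (size w) |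
  Pb (EG_tableau w t)]).
split=> [|t]; first exact: undup_uniq.
rewrite mem_undup mem_filter; split=> [/andP[/PbP]//|h].
apply/andP; split; first exact/PbP.
have [ht [hr [_ hw]]] := (EG_tableauP w t).1 h.
have {hw}hs : sumn (map size t) <= size w.
  by have := hw w (weq_refl _); rewrite size_map size_row_word.
have hn : all (fun r => r != [::]) t.
  by elim: t ht {h hr hs} => //= r t IH /and4P[-> _ _ /IH].
have hi : all (fun r => all (fun a => a \in iota 1 n) r) t.
  have : all (all (fun a => 1 <= a <= n)) t.
    by case: h => _ [_ [h _]].
  by apply: sub_all => r; apply: sub_all => a; rewrite mem_iota add1n ltnS.
have [h1 h2] : size t <= sumn (map size t) /\
    all (fun r => size r <= sumn (map size t)) t.
  elim: t hn {h ht hr hs hi} => //= r t IH /andP[hr /IH[h1 h2]].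
  rewrite -size_eq0 -lt0n in hr; split; first exact: (leq_add hr h1).
  by rewrite leq_addr; apply: sub_all h2 => q /leq_trans; apply; rewrite leq_addl.
apply: mem_bounded_seqs; first exact: leq_trans hs.
apply/allP => r hin; apply: mem_bounded_seqs; last exact: (allP hi).
exact: leq_trans (allP h2 _ hin) hs.
Qed.

(** * Block divisions against primed tableaux *)

Section Bijection.
Variables (n k : nat) (w : seq (Letter n)).
Hypothesis Hw : all (fun i : Letter n => n < i) w.
Implicit Type B : {ffun 'I_k -> {set Letter n}}.

Definition letters B := unzip2 (biword B).
Definition insertion B := (eg (letters B)).1.
Definition recording B := zip (unzip1 (biword B)) (eg (letters B)).2.

Lemma reduced_letters B : reduced_word (block_word B) w -> reduced_for w (letters B).
Proof. by move/(reduced_for_absn _ Hw); rewrite /letters biword_snd. Qed.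

Lemma recordingE B : reduced_word (block_word B) w ->
  unzip1 (recording B) = unzip1 (biword B) /\ unzip2 (recording B) = (eg (letters B)).2.
Proof.
move=> /reduced_letters /reduced_for_reduced h.
have e : size (unzip1 (biword B)) = size (eg (letters B)).2.
  by rewrite (eg_size (egP h)) !size_map.
by rewrite unzip1_zip ?unzip2_zip ?e.
Qed.

Lemma recording_ok B : reduced_word (block_word B) w ->
  is_recording k (sh (insertion B)) (recording B).
Proof.
move=> hB; have h := reduced_for_reduced (reduced_letters hB).
have [e1 e2] := recordingE hB; have [h1 _ _ h4 h5 h6] := egP h.
split.
- rewrite /recording -(biword_sorted h) ?size_map //.
  by rewrite zip_unzip; apply: sorted_biword.
- rewrite -(all_map fst (fun a => a < k.*2)) -/(unzip1 _) e1 all_map.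
  exact: biword_bound.
- by rewrite e2.
- by move=> r; rewrite e2 h4.
Qed.

Lemma recording_inj B B' : reduced_word (block_word B) w ->
  reduced_word (block_word B') w ->
  insertion B = insertion B' -> recording B = recording B' -> B = B'.
Proof.
move=> h h' e1 e2; apply: biword_inj.
have [a1 a2] := recordingE h; have [b1 b2] := recordingE h'.
rewrite -[LHS]zip_unzip -[RHS]zip_unzip -a1 -b1 e2; congr zip.
apply: (eg_inj (reduced_for_reduced (reduced_letters h)) (reduced_for_reduced
  (reduced_letters h'))).
rewrite [LHS]surjective_pairing [RHS]surjective_pairing -a2 -b2 e2.
by congr (_, _).
Qed.

(** Inverse insertion of [t] and [unzip2 J] gives the word, [unzip1 J] its blocks; [biword_sorted]
    ensures that these form a block division. *)
Lemma recording_surj t J : EG_tableau w t -> is_recording k (sh t) J ->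
  exists B, [/\ reduced_word (block_word B) w, insertion B = t & recording B = J].
Proof.
move=> ht [h1 h2 h3 h4].
have [s hs es] := eg_EG_surj ht h3 h4; have hr := reduced_for_reduced hs.
have hsz : size (unzip1 J) = size s.
  by rewrite -(eg_size (egP hr)) es /= !size_map.
have hb : sorted letter_lt (zip (unzip1 J) s).
  by rewrite (biword_sorted hr hsz) es /= zip_unzip.
have [||B eB] := @biword_surj n k _ hb.
- by rewrite -(all_map fst (fun a => a < k.*2)) -/(unzip1 _) unzip1_zip ?hsz // all_map.
- rewrite -(all_map snd (fun a => 1 <= a <= n)) -/(unzip2 _) unzip2_zip ?hsz //.
  by case: hs.
have el : letters B = s by rewrite /letters eB unzip2_zip ?hsz.
exists B; split.
- by apply/(reduced_for_absn _ Hw); rewrite -biword_snd -/(letters B) el.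
- by rewrite /insertion el es.
- by rewrite /recording el es eB unzip1_zip ?hsz //= zip_unzip.
Qed.

(** Recording is a bijection from the block divisions with insertion tableau [t] to the primed
    tableaux of its shape; weights agree since both sides count the values in the first
    components. *)
Lemma Fd_fiber (R : comNzRingType) (x y : 'I_k -> R) t : EG_tableau w t ->
  (\sum_(B : {ffun 'I_k -> {set Letter n}} |
      Pb (reduced_word (block_word B) w) && (t == insertion B))
     \prod_(i < k) (x i ^+ dw1 B i * y i ^+ dw2 B i) = Rskew (sh t) [::] x y)%R.
Proof.
move=> ht; have hlam r r' : r <= r' -> nth 0 (sh t) r' <= nth 0 (sh t) r.
  by apply: tab_size_sorted; case: ((EG_tableauP w t).1 ht).
pose f B := filling_of k (sh t) (recording B).
pose A := [set B | Pb (reduced_word (block_word B) w) && (t == insertion B)].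
have AP B : B \in A -> reduced_word (block_word B) w /\ insertion B = t.
  by rewrite inE => /andP[/PbP h /eqP->].
have Aok B : B \in A -> is_recording k (sh t) (recording B).
  by case/AP=> h <-; apply: recording_ok.
have finj : {in A &, injective f}.
  move=> B B' hB hB' e; have [h1 h2] := AP B hB; have [h3 h4] := AP B' hB'.
  apply: recording_inj => //; first by rewrite h2.
  exact: filling_of_inj (Aok B hB) (Aok B' hB') e.
have fA : f @: A = [set T | Pb (primed_tableau [::] T)].
  apply/setP => T; rewrite inE; apply/imsetP/PbP => [[B hB ->]|hT].
    by apply: filling_of_primed => //; apply: Aok.
  have [J hJ <-] := filling_of_surj hlam hT.
  have [B [h1 h2 h3]] := recording_surj ht hJ.
  by exists B; rewrite ?inE ?h2 ?eqxx ?andbT /f ?h3 //; apply/PbP.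
transitivity (\sum_(B in A) \prod_(i < k) (x i ^+ wX (f B) i * y i ^+ wY (f B) i))%R.
  apply: eq_big => [B|B]; first by rewrite inE.
  case/andP=> /PbP h /eqP e; apply: eq_bigr => i _.
  have hB : B \in A by rewrite inE e eqxx andbT; apply/PbP.
  have [e1 _] := recordingE h.
  rewrite /wX /wY /f (filling_of_weight _ (Aok B hB)) (filling_of_weight _ (Aok B
    hB)) e1.
  by rewrite dw1E dw2E.
rewrite -(big_imset (fun T => \prod_(i < k) (x i ^+ wX T i * y i ^+ wY T i))%R finj) fA.
by apply: eq_bigl => T; rewrite inE.
Qed.

End Bijection.

(* omega in A_n is represented by a word w in s_1,...,s_n (letters with index
   a >= 1, i.e. encoding i = a + n > n).  The identity of formal power series
   in infinitely many variables is stated as the identity for every finite k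
   (specialising the extra variables to 0), and polynomial identity is stated
   as equality under every evaluation in every commutative ring. *)
Theorem theorem2p2 (n : nat) (w : seq (Letter n))
    (Hw : all (fun i : Letter n => (n < i)%N) w) :
  exists ts : seq (seq (seq nat)),
    uniq ts /\ (forall t, t \in ts <-> EG_tableau w t) /\
    forall (k : nat) (R : comNzRingType) (x y : 'I_k -> R),
      Fd w x y = (\sum_(t <- ts) Rskew (sh t) [::] x y)%R.
Proof.
have [ts [hu hts]] := EG_finite w; exists ts; split=> //; split=> // k R x y.
rewrite big_seq.
under eq_bigr => t /hts ht do rewrite -(Fd_fiber Hw x y ht) big_mkcondr /=.
rewrite -big_seq exchange_big /=; apply: eq_bigr => B /PbP hB.
(* In the inner sum over [ts] only [insertion B] contributes, and it occurs there once. *)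
have hin : insertion B \in ts by apply/hts/eg_EG/(reduced_letters Hw hB).
by rewrite (bigD1_seq _ hin hu) /= eqxx [X in (_ + X)%R]big1 ?GRing.addr0 // =>
  t /negbTE ->.
Qed.
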